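(* Assume that the numerical Hamiltonian $g=(g_j)_{j\in J}$ satisfies (G1)--(G4) and that the operators $V_h$ satisfy (V1) (all listed in the context). Then, for every admissible discretization step $h$, the discrete stationary Mean Field Game problem on the network: find grid functions $U,M$ and $\Lambda\in\mathbb R$ such that $$ \begin{cases} -\nu_j (D^2_h U)_{j,k}+g(x_{j,k},[D_hU]_{j,k})+\Lambda=(V_h[M])_{j,k}, & k=1,\dots,N^h_j-1,\ j\in J,\\ \nu_j(D^2_hM)_{j,k}+\mathcal B^h(U,M)_{j,k}=0, & k=1,\dots,N^h_j-1,\ j\in J,\\ \mathcal S^h(U,V_h[M]-\Lambda)_i=0,\quad \mathcal T^h(M,U)_i=0,\quad U \text{ continuous at } v_i, & i\in I,\\ M\in\mathcal K_h,\qquad (U,1)_2=0, \end{cases} $$ has at least one solution $(U,M,\Lambda)$. Moreover $$|\Lambda|\le C_1,\qquad \|U\|_\infty+\|D_hU\|_\infty\le C_2,$$ for some constants $C_1,C_2$ independent of $h$.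
   Context: Network. $\Gamma=(\mathcal V,\mathcal E)$ is a connected network: a finite set of vertices $\mathcal V=\{v_i\}_{i\in I}\subset\mathbb R^n$ and a finite collection $\mathcal E=\{e_j\}_{j\in J}$ of continuous non self-intersecting arcs with endpoints in $\mathcal V$; $e_j$ is parametrized by a smooth $\pi_j:[0,l_j]\to\mathbb R^n$, $l_j>0$. The network has no boundary, i.e. transition conditions are imposed at every vertex. $\nu_j>0$, $j\in J$, are given. $\mathrm{Inc}_i^+=\{j: v_i=\pi_j(0)\}$, $\mathrm{Inc}_i^-=\{j: v_i=\pi_j(l_j)\}$, $\mathrm{Inc}_i=\mathrm{Inc}_i^+\cup \mathrm{Inc}_i^-$ (edges incident to $v_i$). Grid. A discretization step is $h=(h_j)_{j\in J}$, $h_j>0$, with $N^h_j=l_j/h_j$ an integer ($\ge 2$); $y_{j,k}=kh_j$, $x_{j,k}=\pi_j(y_{j,k})$, $0\le k\le N^h_j$. A grid function is a family $U=(U_{j,k})_{j\in J,\,0\le k\le N_j^h}$. It is continuous at $v_i$ if its values at all the grid indices corresponding to $v_i$ (index $(j,0)$ for $j\in\mathrm{Inc}_i^+$, index $(j,N^h_j)$ for $j\in\mathrm{Inc}_i^-$) coincide; it is continuous if it is continuous at every $v_i$. Constants are identified with constant grid functions. $\|U\|_\infty=\max_{j,k}|U_{j,k}|$. Operators. $(D^+U)_{j,k}=(U_{j,k+1}-U_{j,k})/h_j$; $[D_hU]_{j,k}=((D^+U)_{j,k},(D^+U)_{j,k-1})^T$; $(D^2_hU)_{j,k}=(U_{j,k-1}-2U_{j,k}+U_{j,k+1})/h_j^2$;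 $\|D_hU\|_\infty=\max_{j\in J}\max_{0\le k\le N^h_j-1}|(D^+U)_{j,k}|$. $$(U,W)_2=\sum_{j\in J}\sum_{k=1}^{N^h_j-1}h_jU_{j,k}W_{j,k}+\sum_{i\in I}\Big(\sum_{j\in\mathrm{Inc}_i^+}\tfrac{h_j}{2}U_{j,0}W_{j,0}+\sum_{j\in\mathrm{Inc}_i^-}\tfrac{h_j}{2}U_{j,N^h_j}W_{j,N^h_j}\Big).$$ $\mathcal K_h=\{M \text{ continuous grid function}: M_{j,k}\ge0,\ (M,1)_2=1\}$. $$\mathcal S^h(U,V)_i=\sum_{j\in\mathrm{Inc}_i^+}\big[\nu_j(D^+U)_{j,0}+\tfrac{h_j}{2}V_{j,0}\big]-\sum_{j\in\mathrm{Inc}_i^-}\big[\nu_j(D^+U)_{j,N^h_j-1}-\tfrac{h_j}{2}V_{j,N^h_j}\big],$$ $$\mathcal T^h(M,U)_i=\sum_{j\in\mathrm{Inc}_i^+}\big[\nu_j(D^+M)_{j,0}+M_{j,1}\tfrac{\partial g}{\partial q_2}(x_{j,1},[D_hU]_{j,1})\big]-\sum_{j\in\mathrm{Inc}_i^-}\big[\nu_j(D^+M)_{j,N^h_j-1}+M_{j,N^h_j-1}\tfrac{\partial g}{\partial q_1}(x_{j,N^h_j-1},[D_hU]_{j,N^h_j-1})\big].$$ For $k=1,\dots,N_j^h-1$, with $g^s_{j,k}:=\frac{\partial g}{\partial q_s}(x_{j,k},[D_hU]_{j,k})$, $s=1,2$, $$\mathcal B^h(U,M)_{j,k}=\tfrac1{h_j}\big[M_{j,k}g^1_{j,k}-M_{j,k-1}g^1_{j,k-1}+M_{j,k+1}g^2_{j,k+1}-M_{j,k}g^2_{j,k}\big],$$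 where the term $M_{j,k-1}g^1_{j,k-1}$ is omitted when $k=1$ and the term $M_{j,k+1}g^2_{j,k+1}$ is omitted when $k=N^h_j-1$. Hamiltonians. $H_j:[0,l_j]\times\mathbb R\to\mathbb R$, $j\in J$, are continuous and convex in the second variable. The numerical Hamiltonians are $g_j:[0,l_j]\times\mathbb R^2\to\mathbb R$, $(x,q_1,q_2)\mapsto g_j(x,q_1,q_2)$, and $g(x_{j,k},\cdot)$ means $g_j(y_{j,k},\cdot)$. Assumptions: (G1) $g_j$ is nonincreasing in $q_1$ and nondecreasing in $q_2$. (G2) $g_j(x,q,q)=H_j(x,q)$ for all $x\in[0,l_j]$, $q\in\mathbb R$. (G3) $g_j$ is of class $C^1$. (G4) $g_j(x,q_1,q_2)\ge\alpha((q_1^-)^2+(q_2^+)^2)^{\gamma/2}-C$ for some $\alpha>0$, $C\in\mathbb R$, $\gamma>1$, where $q^+=\max(q,0)$, $q^-=\max(-q,0)$. For each $h$, $V_h$ is an operator mapping $\mathcal K_h$ to grid functions. (V1) $V_h$ is continuous and maps $\mathcal K_h$ into a bounded set of grid functions, the bound in $\|\cdot\|_\infty$ being independent of $h$. *)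

(* Defs.v *)
(* MathComp-Analysis; the real numbers are an arbitrary [R : realType]. *)
From HB Require Import structures.
From mathcomp Require Export all_boot all_order all_algebra.
From mathcomp Require Export all_classical all_reals all_analysis.
Export Order.TTheory GRing.Theory Num.Theory.
Export numFieldNormedType.Exports.

Set Implicit Arguments.
Unset Strict Implicit.
Unset Printing Implicit Defensive.

Local Open Scope classical_set_scope.
Local Open Scope ring_scope.

Section Regularity.
Context {R : realType}.

(* Functions on a closed domain are represented by total functions whose values
   outside the domain are irrelevant.  On [0, l] and on [0, l] x R^2, having
   (one-sided at the boundary) continuous derivatives is the same as being the
   restriction of a function that is regular on the whole space. *)
Definition smooth_on_itv n (l : R) (f : R -> 'rV[R]_n) : Prop :=
  exists2 F : R -> 'rV[R]_n,
    forall (k : nat) (t : R), derivable (derive1n k F) t 1 &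
    {in `[0, l], F =1 f}.

Definition C1_on (A : set (R * R * R)) (f : R * R * R -> R) : Prop :=
  exists F : R * R * R -> R,
    [/\ forall p, differentiable F p,
        forall v, continuous (fun p => 'd F p v)
      & {in A, F =1 f}].

End Regularity.

Record network_data (R : realType) (n : nat) (I J : finType) := NetworkData {
  vtx : I -> 'rV[R]_n;
  len : J -> R;
  arc : J -> R -> 'rV[R]_n  (* pi_j, relevant on [0, len j] only *)
}.

Section Network.
Context {R : realType} {n : nat} {I J : finType}.
Variable G : network_data R n I J.

Definition incp (i : I) : {set J} := [set j | vtx G i == arc G j 0]%SET.
Definition incm (i : I) : {set J} := [set j | vtx G i == arc G j (len G j)]%SET.
Definition inc (i : I) : {set J} := (incp i :|: incm i)%SET.

Definition adjacent : rel I :=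
  fun i i' => [exists j, (j \in inc i) && (j \in inc i')].

(* At least one edge is required: on a one-point network without edges,
   (M, 1)_2 = 0 for every M. *)
Record is_network : Prop := IsNetwork {
  vtx_inj : injective (vtx G);
  has_edge : (0 < #|J|)%N;
  len_gt0 : forall j, 0 < len G j;
  arc_smooth : forall j, smooth_on_itv (len G j) (arc G j);
  arc_inj : forall j, {in `[0, len G j] &, injective (arc G j)};
  arc_start : forall j, exists i, j \in incp i;
  arc_end : forall j, exists i, j \in incm i;
  graph_connected : forall i i', connect adjacent i i'
}.

Definition nsteps (h : J -> R) (j : J) : nat := Num.truncn (len G j / h j).

Definition admissible (h : J -> R) : Prop :=
  forall j, [/\ 0 < h j, len G j / h j \is a Num.nat & (2 <= nsteps h j)%N].

Definition grid_fun (h : J -> R) : Type := forall j, 'I_(nsteps h j).+1 -> R.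

(* U_{j,k}, used only for k <= nsteps h j, where [inord k] has value k. *)
Definition gval (h : J -> R) (U : grid_fun h) (j : J) (k : nat) : R :=
  U j (inord k).

Definition gcst (h : J -> R) (c : R) : grid_fun h := fun _ _ => c.

Definition gsub (h : J -> R) (U W : grid_fun h) : grid_fun h :=
  fun j k => U j k - W j k.

Definition gcontinuous_at (h : J -> R) (U : grid_fun h) (i : I) : Prop :=
  exists c : R, (forall j, j \in incp i -> gval U j 0 = c) /\
                (forall j, j \in incm i -> gval U j (nsteps h j) = c).

Definition gcontinuous (h : J -> R) (U : grid_fun h) : Prop :=
  forall i, gcontinuous_at U i.

Definition gnorm (h : J -> R) (U : grid_fun h) : R :=
  \big[Num.max/0]_(j : J) \big[Num.max/0]_(k < (nsteps h j).+1) `|U j k|.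

Definition dplus (h : J -> R) (U : grid_fun h) (j : J) (k : nat) : R :=
  (gval U j k.+1 - gval U j k) / h j.

Definition dd2 (h : J -> R) (U : grid_fun h) (j : J) (k : nat) : R :=
  (gval U j k.-1 - 2 * gval U j k + gval U j k.+1) / h j ^+ 2.

Definition dnorm (h : J -> R) (U : grid_fun h) : R :=
  \big[Num.max/0]_(j : J) \big[Num.max/0]_(k < nsteps h j) `|dplus U j k|.

Definition gdot (h : J -> R) (U W : grid_fun h) : R :=
  \sum_(j : J) \sum_(1 <= k < nsteps h j) h j * gval U j k * gval W j k
  + \sum_(i : I)
     (\sum_(j in incp i) h j / 2 * gval U j 0 * gval W j 0
      + \sum_(j in incm i)
          h j / 2 * gval U j (nsteps h j) * gval W j (nsteps h j)).

Definition Kset (h : J -> R) : set (grid_fun h) :=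
  [set M | [/\ gcontinuous M, forall j k, 0 <= M j k & gdot M (gcst 1) = 1]].

(* A family x, q1, q2 |-> g_j(x, q1, q2), relevant for x in [0, len j]. *)
Definition num_ham : Type := J -> R -> R -> R -> R.

Definition dgq1 (g : num_ham) (j : J) (x q1 q2 : R) : R :=
  derive1 (fun q : R => g j x q q2) q1.
Definition dgq2 (g : num_ham) (j : J) (x q1 q2 : R) : R :=
  derive1 (fun q : R => g j x q1 q) q2.

(* A function of (x, q1, q2) along the grid: at (j, k), 1 <= k < nsteps h j,
   x is y_{j,k} = k h_j and
   (q1, q2) = [D_h U]_{j,k}. *)
Definition along (h : J -> R) (f : num_ham) (U : grid_fun h) (j : J) (k : nat)
    : R :=
  f j (k%:R * h j) (dplus U j k) (dplus U j k.-1).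

Definition Sop (nu : J -> R) (h : J -> R) (U V : grid_fun h) (i : I) : R :=
  \sum_(j in incp i) (nu j * dplus U j 0 + h j / 2 * gval V j 0)
  - \sum_(j in incm i)
      (nu j * dplus U j (nsteps h j).-1 - h j / 2 * gval V j (nsteps h j)).

Definition Top (nu : J -> R) (g : num_ham) (h : J -> R) (M U : grid_fun h)
    (i : I) : R :=
  \sum_(j in incp i) (nu j * dplus M j 0 + gval M j 1 * along (dgq2 g) U j 1)
  - \sum_(j in incm i)
      (nu j * dplus M j (nsteps h j).-1
       + gval M j (nsteps h j).-1 * along (dgq1 g) U j (nsteps h j).-1).

Definition Bop (g : num_ham) (h : J -> R) (U M : grid_fun h) (j : J) (k : nat)
    : R :=
  (h j)^-1 *
  (gval M j k * along (dgq1 g) U j k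
   - (if k == 1%N then 0 else gval M j k.-1 * along (dgq1 g) U j k.-1)
   + (if k == (nsteps h j).-1 then 0
      else gval M j k.+1 * along (dgq2 g) U j k.+1)
   - gval M j k * along (dgq2 g) U j k).

Record hamiltonian (H : J -> R -> R -> R) : Prop := Hamiltonian {
  ham_continuous : forall j,
    {within [set p : R * R | 0 <= p.1 <= len G j],
      continuous (fun p => H j p.1 p.2)};
  ham_convex : forall j x, 0 <= x <= len G j ->
    convex_function [set: R^o] (H j x)
}.

Definition G1 (g : num_ham) : Prop := forall j x, 0 <= x <= len G j ->
  (forall q q' q2, q <= q' -> g j x q' q2 <= g j x q q2) /\
  (forall q1 q q', q <= q' -> g j x q1 q <= g j x q1 q').

Definition G2 (H : J -> R -> R -> R) (g : num_ham) : Prop :=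
  forall j x q, 0 <= x <= len G j -> g j x q q = H j x q.

Definition G3 (g : num_ham) : Prop := forall j,
  C1_on [set p | 0 <= p.1.1 <= len G j] (fun p => g j p.1.1 p.1.2 p.2).

Definition G4 (g : num_ham) : Prop :=
  exists alpha C gamma : R, [/\ 0 < alpha, 1 < gamma &
    forall j x q1 q2, 0 <= x <= len G j ->
      alpha * (Num.max (- q1) 0 ^+ 2 + Num.max q2 0 ^+ 2) `^ (gamma / 2) - C
      <= g j x q1 q2].

(* Only the values of V h on [Kset h] matter. *)
Definition V1 (V : forall h : J -> R, grid_fun h -> grid_fun h) : Prop :=
  (forall h, admissible h -> forall M, Kset M ->
     forall eps : R, 0 < eps -> exists2 delta : R, 0 < delta &
       forall M' : grid_fun h, Kset M' -> gnorm (gsub M' M) < delta ->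
         gnorm (gsub (V h M') (V h M)) < eps) /\
  (exists B : R, forall h, admissible h ->
     forall M : grid_fun h, Kset M -> gnorm (V h M) <= B).

Record mfg_solution (nu : J -> R) (g : num_ham)
    (V : forall h : J -> R, grid_fun h -> grid_fun h)
    (h : J -> R) (U M : grid_fun h) (Lambda : R) : Prop := MfgSolution {
  mfg_hjb : forall j k, (1 <= k < nsteps h j)%N ->
    - nu j * dd2 U j k + along g U j k + Lambda = gval (V h M) j k;
  mfg_fp : forall j k, (1 <= k < nsteps h j)%N ->
    nu j * dd2 M j k + Bop g U M j k = 0;
  mfg_kirchhoff_U : forall i, Sop nu U (gsub (V h M) (gcst Lambda)) i = 0;
  mfg_kirchhoff_M : forall i, Top nu g M U i = 0;
  mfg_continuous_U : forall i, gcontinuous_at U i;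
  mfg_density : Kset M;
  mfg_normalized : gdot U (gcst 1) = 0
}.

End Network.

(* Main.v *)
Require Import Defs.
From mathcomp Require Import ring lra zify.

Set Implicit Arguments.
Unset Strict Implicit.
Unset Printing Implicit Defensive.

(** Bounds.  At a maximum of U the monotonicity of g compares the equation with
    g(x, 0, 0), and at a minimum likewise, so that |Lambda| is at most
    sup |V| + sup |g(x, 0, 0)|.  Since g is bounded below, the second differences
    of U are then bounded below on every edge ([relaxed_semiconvex]), and so is the
    weighted sum of the outward slopes at each vertex ([relaxed_kirchhoff]).  This
    already bounds the gradient, whatever the step.  If U leaves a vertex along an
    edge with a steep slope, semiconvexity keeps the slope steep up to the other
    end, where U is larger; there the outward slope along this edge is very
    negative, so that U has to leave that end steeply along another edge.  As U
    increases along the walk, it never returns to a vertex, and there are finitely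
    many of them ([outward_slope_bound]).  Connectedness then bounds the oscillation
    of U, and the vanishing mean bounds U itself.

    Existence.  One application of Brouwer's theorem to the pair (U, M) suffices,
    without solving either equation for a frozen right-hand side.  The new U is
    the explicit step (U minus the residual of its equation), truncated to
    [-r, r], with Lambda replaced by the value of U at one grid point; the new M
    is the explicit step for the transport equation, projected onto K_h by
    [normalize].  In a fixed point U solves its equation wherever |U| < r, and at
    a point where U = r or U = - r the residual has a sign ([relaxed_solution]).
    Such a point is an extremum, so the sign is exactly what the a priori bounds
    need: they hold with constants independent of r.  As Lambda is a value of U,
    they bound U, hence a large r is never reached and U is a solution.  For M the
    scheme is conservative ([fp_conservation]), and the residual is nonnegative
    where M vanishes; therefore neither truncating at 0 nor renormalizing the mass
    changes anything in a fixed point ([fp_fixed]).  A constant is finally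
    subtracted from U.

    Brouwer's theorem is obtained from Scarf's variant of Sperner's lemma, in which
    the simplices of a triangulation are replaced by the sets that are dominant for
    a family of linear orders ([colourful_dominant]).  Only finite sets and ranks
    are involved, and the orders by coordinates on the grid points of a simplex
    make dominant sets small ([sperner_grid]). *)

Local Open Scope ring_scope.

(** * Sperner's lemma for a family of linear orders *)

Section IndexedOrders.
Import mathcomp.boot.finset.
Local Open Scope set_scope.
Local Open Scope nat_scope.
Variables (E I : finType) (r : I -> E -> nat).
Hypothesis r_inj : forall i, injective (r i).

(** The linear order of index [i] is given by the injective rank [r i].  A set is
    dominant when no element lies, in all the orders at once, strictly above the
    lowest element of the set; dominant sets with as many elements as there are indices (rooms) and with one
    element less (doors) play the part of the simplices and facets of a
    triangulation. *)
Definition dominant (S : {set E}) : bool :=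
  [forall y, exists i, [forall x in S, r i y <= r i x]].

Lemma dominantP (S : {set E}) :
  reflect (forall y, exists i, forall x, x \in S -> r i y <= r i x)
          (dominant S).
Proof.
apply: (iffP forallP) => [dS y|dS y].
  by have /existsP[i /forall_inP le_y] := dS y; exists i.
by have [i le_y] := dS y; apply/existsP; exists i; apply/forall_inP.
Qed.

Lemma dominantS (S S' : {set E}) : S \subset S' -> dominant S' -> dominant S.
Proof.
move=> /fintype.subsetP sSS' /dominantP dS'; apply/dominantP => y.
by have [i le_y] := dS' y; exists i => x /sSS'; apply: le_y.
Qed.

Definition lowest (S : {set E}) (i : I) (x : E) : bool :=
  (x \in S) && [forall z in S, r i x <= r i z].

Lemma lowestP (S : {set E}) i x :
  reflect (x \in S /\ forall z, z \in S -> r i x <= r i z) (lowest S i x).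
Proof.
by apply: (iffP andP) => -[xS /forall_inP]; split=> //; apply/forall_inP.
Qed.

Lemma lowest_fun (S : {set E}) (x0 : E) : x0 \in S ->
  exists m : I -> E, forall i, lowest S i (m i).
Proof.
move=> x0S; exists (fun i => [arg min_(x < x0 in S) r i x]) => i.
by case: arg_minnP => // x xS lex; apply/lowestP.
Qed.

Lemma lowest_uniq (S : {set E}) i x y : lowest S i x -> lowest S i y -> x = y.
Proof.
move=> /lowestP[xS lex] /lowestP[yS ley]; apply: (@r_inj i).
by apply/eqP; rewrite eqn_leq lex ?ley.
Qed.

(** Applied to an element of [S] itself, dominance produces an index for which
    this element is the lowest one. *)
Lemma dominant_lowest (S : {set E}) (m : I -> E) :
  dominant S -> (forall i, lowest S i (m i)) -> m @: [set: I] = S.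
Proof.
move=> /dominantP dS lm; apply/setP => x; apply/imsetP/idP.
  by move=> [i _ ->]; have /lowestP[] := lm i.
move=> xS; have [i lex] := dS x; exists i => //.
by apply: (@lowest_uniq S i) => //; apply/lowestP.
Qed.

(** When an element completes a door to a room and becomes lowest for the index
    [i], it lies above the lowest elements [m k] of the door for the other
    indices [k]. *)
Definition above (m : I -> E) (i : I) : {set E} :=
  [set y | [forall k in ~: [set i], r k (m k) < r k y]].

Lemma aboveP (m : I -> E) i y :
  reflect (forall k, k != i -> r k (m k) < r k y) (y \in above m i).
Proof.
rewrite inE; apply: (iffP forall_inP) => [h k ki|h k].
  by apply: h; rewrite !inE.
by rewrite !inE; apply: h.
Qed.

Definition highest (m : I -> E) (i : I) : {set E} :=
  [set y in above m i | [forall z in above m i, r i z <= r i y]].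

Lemma card_highest (m : I -> E) i : #|highest m i| = (above m i != set0).
Proof.
case: eqVneq => [M0|/set0Pn[y0 y0M]].
  by apply/eqP; rewrite cards_eq0; apply/eqP/setP=> y; rewrite /highest M0 !inE.
pose y := [arg max_(y > y0 in above m i) r i y].
suff -> : highest m i = [set y] by rewrite cards1.
rewrite /y; case: arg_maxnP => // {}y yM ley.
apply/setP => z; rewrite !inE; apply/idP/eqP => [/andP[zM lez]|->].
  apply: (@r_inj i); apply/eqP; rewrite eqn_leq.
  rewrite (forall_inP lez) ?andbT //.
  by apply: ley; rewrite inE.
rewrite inE in yM; rewrite yM; apply/forall_inP => z' z'M.
by apply: ley.
Qed.

Section Door.
Variables (D : {set E}) (m : I -> E).
Hypotheses (D_dom : dominant D) (D_card : #|D|.+1 = #|I|).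
Hypothesis m_low : forall i, lowest D i (m i).

Let mD i : m i \in D. Proof. by have /lowestP[] := m_low i. Qed.
Let m_le i z : z \in D -> r i (m i) <= r i z.
Proof. by have /lowestP[_] := m_low i; apply. Qed.

(** There is one index more than there are elements. *)
Lemma door_pair : exists a b, a != b /\ m a = m b.
Proof.
have : ~~ injectiveb m.
  apply/negP => /injectiveP m_inj; have := card_imset [set: I] m_inj.
  by rewrite (dominant_lowest D_dom m_low) cardsT -D_card; lia.
by move=> /injectivePn[a [b ab mab]]; exists a, b.
Qed.

(** Leaving out [i] keeps all the elements of [D] as lowest elements exactly when
    another index has the same lowest element as [i]. *)
Lemma door_free (a b i : I) : a != b -> m a = m b ->
  (m @: (~: [set i]) == D) = (i \in [set a; b]).
Proof.
move=> ab mab; apply/eqP/idP => [mi|].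
  apply: contraTT isT => iab.
  have /imset_injP inj : #|m @: (~: [set i])| == #|~: [set i]|.
    by rewrite mi cardsC1 -D_card.
  have /inj : a \in ~: [set i].
    by rewrite !inE; apply: contraNneq iab => ->; rewrite !inE eqxx.
  move=> /(_ b); rewrite !inE => /(_ _ mab) E'.
  move: ab; rewrite E' ?eqxx //.
  by apply: contraNneq iab => ->; rewrite !inE eqxx orbT.
move=> iab; have mT := dominant_lowest D_dom m_low.
apply/eqP; rewrite eqEsubset; apply/andP; split.
  by apply/fintype.subsetP => _ /imsetP[k _ ->].
apply/fintype.subsetP => x; rewrite -{1}mT => /imsetP[k _ ->].
have [->|ki] := eqVneq k i; last by apply: imset_f; rewrite !inE.
move: iab; rewrite !inE => /orP[]/eqP->; [rewrite mab|rewrite -mab];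
  by apply: imset_f; rewrite !inE // eq_sym.
Qed.

(** In the room [y |: D] every element is lowest for exactly one index.  If [y]
    is lowest for [i], the other indices have to exhaust [D], so that [i] is [a]
    or [b]; and [y] is the highest candidate, since a higher one would lie above
    the lowest elements of the room in all the orders. *)
Lemma door_rooms (a b : I) : a != b -> m a = m b ->
  [set y in ~: D | dominant (y |: D)] = highest m a :|: highest m b.
Proof.
move=> ab mab; apply/setP => y; rewrite [LHS]inE in_setC in_setU; apply/idP/idP.
  move=> /andP[yD dyD].
  have [m' m'_low] := @lowest_fun (y |: D) y (setU11 _ _).
  have m'T := dominant_lowest dyD m'_low.
  have m'_inj : injective m'.
    have : #|m' @: [set: I]| == #|[set: I]|.
      by rewrite m'T cardsU1 yD cardsT -D_card.
    by move=> /imset_injP inj k l; apply: inj.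
  have [i m'i] : exists i, m' i = y.
    have : y \in m' @: [set: I] by rewrite m'T setU11.
    by move=> /imsetP[i _ ->]; exists i.
  have m'm k : k != i -> m' k = m k.
    move=> ki; have /lowestP[] := m'_low k; rewrite !inE => /orP[/eqP E'|m'D].
      by move: ki; rewrite -(inj_eq m'_inj) m'i E' eqxx.
    move=> lem'; apply: (@lowest_uniq D k) => //; apply/lowestP; split=> //.
    by move=> z zD; apply: lem'; rewrite !inE zD orbT.
  have yM : y \in above m i.
    apply/aboveP => k ki; rewrite -(m'm _ ki) ltn_neqAle.
    have /lowestP[_ ->] := m'_low k; rewrite ?setU11 // andbT.
    apply/eqP => /r_inj E'; move: ki; rewrite -(inj_eq m'_inj) E' m'i.
    by rewrite eqxx.
  have yhigh : y \in highest m i.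
    rewrite inE yM; apply/forall_inP => z /aboveP zM.
    have /dominantP/(_ z)[k lez] := dyD.
    have [ki|ki] := eqVneq k i; first by rewrite -ki; apply: lez; rewrite setU11.
    have := zM k ki; rewrite ltnNge lez // -(m'm _ ki).
    by have /lowestP[] := m'_low k.
  have : i \in [set a; b].
    rewrite -(door_free _ ab mab) eqEsubset; apply/andP; split.
      by apply/fintype.subsetP => _ /imsetP[k _ ->].
    apply/fintype.subsetP => x xD; have : x \in m' @: [set: I].
      by rewrite m'T !inE xD orbT.
    move=> /imsetP[k _ xk]; have ki : k != i.
      by apply: contraNneq yD => ki; rewrite -m'i -ki -xk.
    by rewrite xk (m'm _ ki); apply: imset_f; rewrite !inE.
  by rewrite in_set2 => /orP[]/eqP <-; rewrite yhigh ?orbT.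
move=> /orP yab.
have [i iab] : exists2 i, i \in [set a; b] & y \in highest m i.
  by case: yab => yt; [exists a|exists b]; rewrite // in_set2 eqxx ?orbT.
rewrite inE => /andP[/aboveP yM /forall_inP ymax].
have mi : m @: (~: [set i]) = D by apply/eqP; rewrite (door_free _ ab mab).
have yD : y \notin D.
  apply/negP; rewrite -mi => /imsetP[k]; rewrite !inE => ki yk.
  by have := yM k ki; rewrite yk ltnn.
rewrite yD /=.
have yle z : z \in D -> r i y <= r i z.
  have /dominantP/(_ y)[k lek] := D_dom.
  have [<-|ki] := eqVneq k i; first exact: lek.
  by have := yM k ki; rewrite ltnNge lek.
apply/dominantP => z; case: (boolP (z \in above m i)) => zM.
  exists i => x; rewrite !inE => /orP[/eqP->|xD]; first exact: ymax.
  by apply: leq_trans (ymax z zM) (yle _ xD).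
have [k ki zk] : exists2 k, k != i & r k z <= r k (m k).
  move: zM; rewrite inE negb_forall => /existsP[k].
  by rewrite negb_imply !inE -leqNgt => /andP[ki zk]; exists k.
exists k => x; rewrite !inE => /orP[/eqP->|xD].
  by apply: leq_trans zk (ltnW (yM k ki)).
exact: leq_trans zk (m_le _ xD).
Qed.

(** An element of both sets would lie above the lowest elements of [D] in all the
    orders. *)
Lemma door_highest_disjoint (a b : I) : a != b -> [disjoint highest m a & highest m b].
Proof.
move=> ab; rewrite -setI_eq0; apply/eqP/setP => y; rewrite !inE.
apply/negP => /andP[/andP[ya _] /andP[yb _]].
have {ya yb} [/aboveP ya /aboveP yb] : y \in above m a /\ y \in above m b.
  by rewrite !inE.
have /dominantP/(_ y)[k lek] := D_dom.
have [ka|ka] := eqVneq k a.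
  by have := yb k; rewrite ka ab => /(_ isT); rewrite -ka ltnNge lek.
by have := ya k ka; rewrite ltnNge lek.
Qed.

Lemma door_card (a b : I) : a != b -> m a = m b ->
  #|[set y in ~: D | dominant (y |: D)]| =
    (above m a != set0) + (above m b != set0).
Proof.
move=> ab mab; rewrite (door_rooms ab mab) cardsU.
have /eqP -> : highest m a :&: highest m b == set0.
  by rewrite setI_eq0 door_highest_disjoint.
by rewrite cards0 subn0 !card_highest.
Qed.

End Door.

(* [e i] stands for the face of the simplex opposite to the vertex [i]: it lies
   below all the other elements in the order [i] and above all the proper ones in
   the other orders. *)
Variables (e : I -> E) (c : E -> I) (i0 : I) (t0 : E).
Hypotheses (I_gt1 : 1 < #|I|) (c_e : forall i, c (e i) = i).
Hypothesis e_low : forall i y, y != e i -> r i (e i) < r i y.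
Hypothesis e_high :
  forall i k y, k != i -> y \notin codom e -> r i y < r i (e k).
Hypothesis t0_proper : t0 \notin codom e.

Let e_inj : injective e. Proof. exact: can_inj c_e. Qed.

Let imset_ce (A : {set I}) : c @: (e @: A) = A.
Proof.
by rewrite -imset_comp -[RHS]imset_id; apply: eq_imset => i; apply: c_e.
Qed.

Let e_least i y : r i (e i) <= r i y.
Proof. by case: (eqVneq y (e i)) => [->//|yi]; apply/ltnW/e_low. Qed.

(** A door has two rooms because [e a] and [e b] are candidates for completing
    it.  This fails only if the lowest element for some index is the slack of
    another index; then [D] has no proper element, and it has a single room. *)
Lemma door_parity (D : {set E}) : dominant D -> c @: D = ~: [set i0] ->
  #|D|.+1 = #|I| ->
  odd #|[set y in ~: D | dominant (y |: D)]| = (D == e @: (~: [set i0])).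
Proof.
move=> dD cD cardD.
have [x0 x0D] : exists x, x \in D by apply/set0Pn; rewrite -cards_eq0; lia.
have [m m_low] := lowest_fun x0D.
have [a [b [ab mab]]] := door_pair dD cardD m_low.
have slackD k : m k \in codom e -> m k != e k -> D = e @: (~: [set k]).
  move=> /codomP[l mk] kl; rewrite mk (inj_eq e_inj) in kl.
  have /lowestP[mD lem] := m_low k.
  have sub : D \subset e @: (~: [set k]).
    apply/fintype.subsetP => x xD; have /codomP[p xp] : x \in codom e.
      apply: contraT => xe; have := e_high kl xe.
      by rewrite -mk ltnNge lem.
    rewrite xp; apply: imset_f; rewrite !inE; apply: contraTneq (lem x xD).
    by move=> pk; rewrite xp pk -ltnNge mk; apply: e_low; rewrite (inj_eq e_inj).
  apply/eqP; rewrite eqEcard sub card_imset // cardsC1 -cardD.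
  by rewrite leqnn.
rewrite (door_card dD cardD m_low ab mab).
have [D_slack|D_proper] := eqVneq D _.
  (* on the boundary door every index but i0 has its own slack as lowest
     element, so that i0 is one of the two indices that share theirs *)
  have mk k : k != i0 -> m k = e k.
    move=> ki0; apply: (lowest_uniq (m_low k)); apply/lowestP; split.
      by rewrite D_slack imset_f // !inE.
    by move=> z _; apply: e_least.
  have M0 : above m i0 != set0.
    apply/set0Pn; exists t0; apply/aboveP => k ki0; rewrite mk //; apply: e_low.
    by apply: contraNneq t0_proper => ->; rewrite codom_f.
  have M1 k : k != i0 -> m i0 = m k -> above m k == set0.
    move=> ki0 mi0; rewrite (mk k ki0) in mi0; apply/eqP/setP => z; rewrite in_set0.
    apply/negP => /aboveP zM.
    have zi0 : r i0 (e k) < r i0 z by rewrite -mi0; apply: zM; rewrite eq_sym.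
    have /codomP[l zl] : z \in codom e.
      apply: contraT => ze; have := e_high ki0 ze; lia.
    have [li0|li0] := eqVneq l i0.
      move: zi0; rewrite zl li0 ltnNge ltnW //; apply: e_low.
      by rewrite (inj_eq e_inj).
    have [lk|lk] := eqVneq l k; first by move: zi0; rewrite zl lk ltnn.
    by have := zM l lk; rewrite zl mk // ltnn.
  have [ai0|ai0] := eqVneq a i0.
    have /eqP -> : above m b == set0 by apply: M1; rewrite -ai0 // eq_sym.
    by rewrite ai0 M0 eqxx.
  have [bi0|bi0] := eqVneq b i0.
    have /eqP -> : above m a == set0 by apply: M1; rewrite -bi0.
    by rewrite bi0 M0 eqxx.
  by move: mab; rewrite (mk a ai0) (mk b bi0) => /e_inj abE; rewrite abE eqxx in ab.
have Mi i : (i \in [set a; b]) -> above m i != set0.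
  move=> iab; apply/set0Pn; exists (e i); apply/aboveP => k ki.
  have [mke|mke] := eqVneq (m k) (e k).
    by rewrite mke; apply: e_low; rewrite (inj_eq e_inj) eq_sym.
  apply: e_high; first by rewrite eq_sym.
  apply/negP => mcod; have Dk := slackD k mcod mke.
  have cDk : c @: D = ~: [set k] by rewrite Dk imset_ce.
  have ki0 : k = i0.
    have : i0 \notin c @: D by rewrite cD !inE eqxx.
    by rewrite cDk !inE negbK => /eqP.
  by move: D_proper; rewrite Dk ki0 eqxx.
by rewrite !Mi // !inE eqxx ?orbT.
Qed.

(** A room that misses the colour [i0] only has exactly two elements of the same
    colour, and removing either of them leaves a door with the colours other than
    [i0]. *)
Lemma room_parity (S : {set E}) : #|S| = #|I| ->
  odd #|[set x in S | c @: (S :\ x) == ~: [set i0]]| = (c @: S == [set: I]).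
Proof.
move=> cardS; set A := [set x in S | _].
have cardSx x : x \in S -> #|S :\ x| = #|I|.-1.
  by move=> xS; rewrite -cardS (cardsD1 x S) xS.
have injA x : x \in A -> {in S :\ x &, injective c}.
  rewrite inE => /andP[xS /eqP cx]; apply/imset_injP.
  by rewrite cx cardsC1 cardSx.
case: eqP => [cS|cS].
  have c_inj : {in S &, injective c}.
    by apply/imset_injP; rewrite cS cardsT cardS.
  have /imsetP[x xS i0x] : i0 \in c @: S by rewrite cS inE.
  suff -> : A = [set x] by rewrite cards1.
  apply/setP => z; rewrite !inE; apply/andP/eqP => [[zS /eqP cz]|->].
    apply: contraTeq isT => zx; have : c x \in c @: (S :\ z).
      by apply: imset_f; rewrite !inE eq_sym zx.
    by rewrite cz -i0x !inE eqxx.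
  split=> //; rewrite eqEcard cardsC1 card_in_imset ?cardSx //; last first.
    by apply: sub_in2 c_inj => y; rewrite !inE => /andP[].
  rewrite leqnn andbT; apply/fintype.subsetP => _ /imsetP[y + ->].
  rewrite !inE => /andP[yx yS]; apply: contra_neq yx => cy.
  by apply: c_inj; rewrite // cy.
case: (set_0Vmem A) => [->|[x xA]]; first by rewrite cards0.
have := xA; rewrite inE => /andP[xS /eqP cx].
have cSx : c @: S = c x |: c @: (S :\ x) by rewrite -imsetU1 setD1K.
have cxi0 : c x != i0.
  apply: contra_notN cS => /eqP cxi0; rewrite cSx cx cxi0.
  by apply/setP=> k; rewrite !inE orbN.
have /imsetP[x' x'Sx cxx'] : c x \in c @: (S :\ x) by rewrite cx !inE.
move: (x'Sx); rewrite !inE => /andP[x'x x'S].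
suff -> : A = [set x; x'] by rewrite cards2 eq_sym x'x.
apply/setP => z; rewrite in_set2; apply/idP/idP => [zA|/orP[]/eqP->//].
  apply: contraT; rewrite negb_or => /andP[zx zx'].
  have := injA z zA x x'; rewrite !inE xS x'S 2!(eq_sym _ z) zx zx'.
  by move=> /(_ isT isT cxx') E'; rewrite E' eqxx in x'x.
rewrite inE x'S -cx eqEsubset /=; apply/andP; split; apply/fintype.subsetP => _ /imsetP[y + ->].
  rewrite !inE => /andP[yx' yS]; have [->|yx] := eqVneq y x.
    by rewrite cxx' imset_f.
  by apply: imset_f; rewrite !inE yx.
rewrite !inE => /andP[yx yS]; have [->|yx'] := eqVneq y x'.
  by rewrite -cxx'; apply: imset_f; rewrite !inE eq_sym x'x.
by apply: imset_f; rewrite !inE yx'.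
Qed.

(** Double counting of the pairs of a room and one of its doors with the colours
    other than [i0]: each such door has an even number of rooms, except the
    boundary door made of all the slacks but one, so the number of rooms having
    an odd number of such doors is odd, and these are the colourful ones. *)
Lemma colourful_dominant :
  exists S : {set E}, [/\ dominant S, #|S| = #|I| & c @: S = [set: I]].
Proof.
pose room (S : {set E}) := dominant S && (#|S| == #|I|).
pose door (D : {set E}) :=
  [&& dominant D, #|D|.+1 == #|I| & c @: D == ~: [set i0]].
pose A := [set p : {set E} * E |
  [&& room p.1, p.2 \in p.1 & c @: (p.1 :\ p.2) == ~: [set i0]]].
pose B := [set p : {set E} * E |
  [&& door p.1, p.2 \notin p.1 & dominant (p.2 |: p.1)]].
have AB : #|A| = #|B|.
  pose f (p : {set E} * E) := (p.1 :\ p.2, p.2).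
  have f_inj : {in A &, injective f}.
    move=> [S x] [S' x']; rewrite !inE /= => /and3P[_ xS _] /and3P[_ xS' _].
    by case=> SS xx'; subst x'; rewrite -(setD1K xS) SS setD1K.
  rewrite -(card_in_imset f_inj); congr #|pred_of_set _|.
  apply/setP => -[D y]; rewrite inE /=; apply/imsetP/and3P.
    move=> [[S x]]; rewrite inE /= => /and3P[/andP[dS cS] xS cx] [-> ->].
    rewrite setD1K // dS !inE eqxx /=; split=> //.
    rewrite /door cx andbT (dominantS _ dS) ?subsetDl //=.
    by rewrite (cardsD1 x) xS in cS.
  move=> [/and3P[dD cD cDi] yD dyD]; exists (y |: D, y); last first.
    by rewrite /f /= setU1K.
  rewrite inE /= setU11 setU1K // cDi /room dyD cardsU1 yD add1n cD.
  by [].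
have splitA (P : pred ({set E} * E)) :
    #|[set p | P p]| = \sum_(S : {set E}) #|[set x | P (S, x)]|.
  rewrite -sum1dep_card (eq_bigl (fun p => P (p.1, p.2))); last by case.
  rewrite -(pair_big_dep xpredT (fun S x => P (S, x)) (fun _ _ => 1)) /=.
  by apply: eq_bigr => S _; rewrite sum1dep_card.
have oddsum (F : {set E} -> nat) :
    odd (\sum_S F S) = odd (\sum_(S | odd (F S)) 1).
  rewrite (bigID (fun S => odd (F S))) /= oddD addbC.
  rewrite (big_morph odd oddD (erefl _)) big1 /=; last first.
    by move=> S /negbTE.
  rewrite (big_morph odd oddD (erefl _)) [RHS](big_morph odd oddD (erefl _)).
  by apply: eq_bigr => S ->.
have oddB : odd #|B|.
  rewrite splitA oddsum (big_pred1 (e @: (~: [set i0]))) // => D.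
  case dD: (door D); last first.
    rewrite (_ : [set x | _] = set0) ?cards0 /=; last first.
      by apply/setP => x; rewrite !inE.
    apply/esym/negbTE; apply: contraFneq dD => ->; apply/and3P; split.
    - apply/dominantP => y; have [/codomP[l ->]|ye] := boolP (y \in codom e).
        by exists l => x _; apply: e_least.
      exists i0 => _ /imsetP[k + ->]; rewrite !inE => ki0.
      exact/ltnW/e_high.
    - by rewrite card_imset // cardsC1 prednK // (ltn_trans _ I_gt1).
    - by rewrite imset_ce.
  case/and3P: (dD) => dD1 /eqP dD2 /eqP dD3.
  have -> : pred1 (e @: (~: [set i0])) D = (D == e @: (~: [set i0])) by [].
  rewrite -(door_parity dD1 dD3 dD2).
  by congr odd; apply: eq_card => y; rewrite !inE.
move: oddB; rewrite -AB splitA oddsum => oddA.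
have [S SA] : exists S,
    odd #|[set x | [&& room S, x \in S & c @: (S :\ x) == ~: [set i0]]]|.
  apply/existsP; apply: contraTT oddA => /existsPn noA.
  by rewrite big_pred0 // => S; apply/negbTE/noA.
case/boolP: (room S) SA => [/andP[dS /eqP cS] SA|_]; last first.
  by rewrite (_ : [set x | _] = set0) ?cards0 //; apply/setP => x; rewrite !inE.
exists S; split=> //; apply/eqP; rewrite -room_parity //.
Qed.
End IndexedOrders.

(** * Dominant sets of grid points of a simplex *)

Section SimplexGrid.
Import mathcomp.boot.finset.
Local Open Scope set_scope.
Local Open Scope nat_scope.

Variables (I : finType) (N : nat) (c : {ffun I -> 'I_N.+1} -> I).

Let T := {t : {ffun I -> 'I_N.+1} | \sum_i t i == N}.
Let E : finType := (T + I)%type.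
Let K := #|{: T}|.

(* The grid points are ordered by their [i]-th coordinate, ties being broken by an
   enumeration; the slacks are placed below and above them. *)
Let r (i : I) (y : E) : nat :=
  match y with
  | inl t => (val t i * K + enum_rank t).+1
  | inr k => if k == i then 0 else (N.+1 * K + enum_rank k).+1
  end.

Let r_lt (i : I) (t : T) : val t i * K + enum_rank t < N.+1 * K.
Proof.
have := ltn_ord (enum_rank t); have := ltn_ord (val t i).
rewrite -/K; set a := nat_of_ord _; set b := nat_of_ord _ => aN bK.
have aK : a * K <= N * K by rewrite leq_mul2r -ltnS aN orbT.
by rewrite mulSn addnC -addSn leq_add.
Qed.

Let r_inj i : injective (r i).
Proof.
move=> [t|k] [t'|k'] //=.
- move=> [E1]; congr inl; apply: enum_rank_inj; apply: val_inj => /=.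
  by have /(congr1 (modn^~ K)) := E1; rewrite !modnMDl !modn_small.
- by case: eqP => // _ [E1]; have := r_lt i t; rewrite E1 -ltn_subRL subnn.
- by case: eqP => // _ [E1]; have := r_lt i t'; rewrite -E1 -ltn_subRL subnn.
- case: eqP => [->|_]; case: eqP => [->|_] // [/addnI E1].
  by congr inr; apply: enum_rank_inj; apply: val_inj.
Qed.

Hypothesis I_gt1 : 1 < #|I|.

Let ffun_of (F : I -> nat) : {ffun I -> 'I_N.+1} := [ffun i => inord (F i)].

Let gridpoint (F : I -> nat) : \sum_i F i = N ->
  {t : T | forall i, val t i = F i :> nat}.
Proof.
move=> sF; have le_F i : F i <= N by rewrite -sF (bigD1 i) //= leq_addr.
have FE i : ffun_of F i = F i :> nat by rewrite ffunE inordK ?ltnS.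
have sT : \sum_i ffun_of F i == N.
  by rewrite (eq_bigr F) ?sF // => i _; rewrite FE.
by exists (exist _ (ffun_of F) sT).
Qed.

Let leq_r i (t t' : T) : r i (inl t) <= r i (inl t') -> val t i <= val t' i.
Proof.
rewrite /= ltnS leqNgt => le_tt'; rewrite leqNgt; apply: contra le_tt' => lt_t't.
have := ltn_ord (enum_rank t'); rewrite -/K => t'K.
apply: (@leq_trans ((val t' i).+1 * K)); first by rewrite mulSn addnC ltn_add2r.
by apply: leq_trans (leq_addr _ _); rewrite leq_mul2r lt_t't orbT.
Qed.

(** Here [x] is a point of a colourful dominant set.  The coordinates of the points
    of this set differ by at most [#|I|], and they are at most [#|I|] for the
    indices whose slack belongs to the set. *)
Lemma sperner_grid : exists x : {ffun I -> 'I_N.+1}, \sum_i x i = N /\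
  forall i, x i <= #|I| \/ exists y : {ffun I -> 'I_N.+1},
    [/\ \sum_i y i = N, c y = i &
        forall k, x k <= y k + #|I| /\ y k <= x k + #|I|].
Proof.
have [i0 _] : exists i, i \in I by apply/card_gt0P; rewrite ltnW.
have [t0 _] : {t : T | forall i, val t i = (if i == i0 then N else 0) :> nat}.
  by apply: gridpoint; rewrite -big_mkcond big_pred1_eq.
pose e k : E := inr k.
pose c' (y : E) : I := match y with inl t => c (val t) | inr k => k end.
have notin_e y : y \notin codom e -> exists t, y = inl t.
  case: y => [t _|k]; first by exists t.
  by case/negP; apply: (codom_f e k).
have [||||S [/dominantP S_dom _ cS]] :=
    @colourful_dominant E I r r_inj e c' i0 (inl t0) I_gt1 _ _ _ _.
- by [].
- move=> i [t|k] //=; rewrite eqxx // /e => ki.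
  by case: eqP => // ki'; rewrite ki' eqxx in ki.
- move=> i k y ki /notin_e[t ->] /=; rewrite (negbTE ki) ltnS.
  by apply: leq_trans (r_lt i t) (leq_addr _ _).
- by apply/codomP => -[].
pose C := [set i | inr i \notin S].
have S_C y : exists2 i, i \in C & forall x : T, inl x \in S -> r i (inl y) <= r i (inl x).
  have [i le_y] := S_dom (inl y); exists i; last by move=> x /le_y.
  by rewrite inE; apply/negP => /le_y /=; rewrite eqxx.
have C_S i : i \in C -> exists2 t : T, inl t \in S & c (val t) = i.
  rewrite inE => iS; have : i \in c' @: S by rewrite cS inE.
  by move=> /imsetP[[t|k] yS ik]; [exists t|rewrite ik /= yS in iS].
have [i1 i1C _] := S_C t0; have [x0 x0S _] := C_S i1 i1C.
pose xmin i := [arg min_(x < x0 | inl x \in S) val x i].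
have xminS i : inl (xmin i) \in S by rewrite /xmin; case: arg_minnP.
have xmin_le i (x : T) : inl x \in S -> val (xmin i) i <= val x i.
  by rewrite /xmin; case: arg_minnP => // y _; apply.
pose mu i : nat := if i \in C then nat_of_ord (val (xmin i) i) else 0.
(* otherwise the point with coordinates mu i + 1 on C could be completed to a
   grid point above the lowest elements of S in all the orders *)
have mu_sum : N < \sum_i (mu i + (i \in C)).
  rewrite ltnNge; apply/negP => le_N.
  pose F i := mu i + (i \in C) +
    (if i == i1 then N - \sum_i (mu i + (i \in C)) else 0).
  have [|t tF] := gridpoint (F := F).
    by rewrite big_split /= -[X in _ + X]big_mkcond big_pred1_eq subnKC.
  have [i iC /(_ _ (xminS i)) /leq_r] := S_C t.
  by rewrite tF /F /mu iC addn1 addSn ltnNge leq_addr.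
have close (x : T) i : inl x \in S -> mu i <= val x i <= mu i + #|I|.
  move=> xS; have [X XE] : exists X : I -> nat, forall k, val x k = X k :> nat.
    by exists (fun k => val x k).
  have mu_x k : mu k <= X k.
    by rewrite /mu -XE; case: ifP => // _; apply: xmin_le.
  have C_I : \sum_i (i \in C : nat) <= #|I|.
    by rewrite -sum1_card leq_sum // => k _; apply: leq_b1.
  have : \sum_i X i < \sum_i (mu i + (i \in C)).
    by rewrite -(eq_bigr _ (fun k _ => XE k)) (eqP (valP x)).
  rewrite XE mu_x big_split /= (bigD1 i) //= [X in _ < X + _](bigD1 i) //=.
  have : \sum_(k | k != i) mu k <= \sum_(k | k != i) X k by apply: leq_sum.
  move=> le_rest lt_sum; rewrite -(leq_add2r (\sum_(k | k != i) X k)).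
  apply: leq_trans (ltnW lt_sum) _; rewrite -!addnA leq_add2l addnC.
  exact: leq_add.
exists (val x0); split=> [|i]; first exact/eqP/(valP x0).
have [/C_S[y yS cy]|iC] := boolP (i \in C); [right|left].
  exists (val y); split=> // [|k]; first exact/eqP/(valP y).
  by have := close x0 k x0S; have := close y k yS; lia.
by have := close x0 i x0S; rewrite /mu (negbTE iC).
Qed.

End SimplexGrid.

(** * Brouwer's fixed point theorem *)

Section RealContinuity.
Context {R : realType} {S : topologicalType}.
Implicit Types f g : S -> R.

Lemma contD f g : continuous f -> continuous g ->
  continuous (fun s => f s + g s).
Proof. by move=> cf cg s; apply: (cvgD (cf s) (cg s)). Qed.

Lemma contN f : continuous f -> continuous (fun s => - f s).
Proof. by move=> cf s; apply: (cvgN (cf s)). Qed.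

Lemma contB f g : continuous f -> continuous g ->
  continuous (fun s => f s - g s).
Proof. by move=> cf cg s; apply: (cvgB (cf s) (cg s)). Qed.

Lemma contM f g : continuous f -> continuous g ->
  continuous (fun s => f s * g s).
Proof. by move=> cf cg s; apply: (cvgM (cf s) (cg s)). Qed.

Lemma contV f : (forall s, f s != 0) -> continuous f ->
  continuous (fun s => (f s)^-1).
Proof. by move=> f0 cf s; apply: (cvgV (f0 s) (cf s)). Qed.

Lemma cont_max f g : continuous f -> continuous g ->
  continuous (fun s => Num.max (f s) (g s)).
Proof. by move=> cf cg s; apply: (@continuous_max _ _ f g s (cf s) (cg s)). Qed.

Lemma cont_min f g : continuous f -> continuous g ->
  continuous (fun s => Num.min (f s) (g s)).
Proof. by move=> cf cg s; apply: (@continuous_min _ _ f g s (cf s) (cg s)). Qed.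

Lemma cont_sum (I : Type) (r : seq I) (P : pred I) (F : I -> S -> R) :
  (forall i, P i -> continuous (F i)) ->
  continuous (fun s => \sum_(i <- r | P i) F i s).
Proof.
move=> F_cont; elim: r => [|i r IHr].
  by under eq_fun do rewrite big_nil; apply: cst_continuous.
under eq_fun do rewrite big_cons.
by case Pi: (P i) => //=; apply: contD; [apply: F_cont|apply: IHr].
Qed.

End RealContinuity.

Section Brouwer.
Local Open Scope classical_set_scope.
Local Open Scope ring_scope.
Context {R : realType}.

(** A grid point is coloured by a coordinate that [f] does not decrease; one
    exists because both sides have sum 1.  In a small set with all the colours,
    every coordinate is then almost not decreased at some point, trivially so if
    it is itself small. *)
Lemma simplex_almost_fixed (d : nat) (f : 'rV[R]_d -> 'I_d -> R) :
  (1 < d)%N -> (forall x i, 0 <= f x i) -> (forall x, \sum_i f x i = 1) ->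
  forall eps : R, 0 < eps -> exists x : 'rV[R]_d,
    [/\ forall i, 0 <= x 0 i <= 1, \sum_i x 0 i = 1 &
        forall i, exists y : 'rV[R]_d,
          (forall k, `|x 0 k - y 0 k| <= eps) /\ y 0 i <= f y i + eps].
Proof.
move=> d_gt1 f_ge0 f_sum eps eps_gt0.
pose N := (Num.truncn (d%:R / eps)).+1.
have N_gt0 : 0 < N%:R :> R by rewrite ltr0n.
have dN : d%:R / N%:R <= eps.
  rewrite ler_pdivrMr // mulrC -ler_pdivrMr //; apply: ltW.
  by apply: truncnS_gt.
pose pt (t : {ffun 'I_d -> 'I_N.+1}) : 'rV[R]_d := \row_i ((t i)%:R / N%:R).
have pt_sum (t : {ffun 'I_d -> 'I_N.+1}) :
    (\sum_i t i = N)%N -> \sum_i pt t 0 i = 1.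
  move=> tN; under eq_bigr do rewrite mxE.
  by rewrite -mulr_suml -natr_sum tN divff // gt_eqF.
pose c (t : {ffun 'I_d -> 'I_N.+1}) : 'I_d :=
  odflt (Ordinal (ltnW d_gt1)) [pick i | pt t 0 i <= f (pt t) i].
have c_le (t : {ffun 'I_d -> 'I_N.+1}) : (\sum_i t i = N)%N -> pt t 0 (c t) <= f (pt t) (c t).
  move=> tN; rewrite /c; case: pickP => //= no_i.
  have : \sum_i f (pt t) i < \sum_i pt t 0 i.
    apply: ltr_sum => [|i _]; last by rewrite ltNge no_i.
    by apply/hasP; exists (Ordinal (ltnW d_gt1)); rewrite ?mem_index_enum.
  by rewrite f_sum pt_sum // ltxx.
have [|x [xN xP]] := @sperner_grid 'I_d N c; first by rewrite card_ord.
rewrite card_ord in xP.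
exists (pt x); split=> [i||i]; last 2 first.
- exact: pt_sum.
- have [xi|[y [yN cy xy]]] := xP i.
    exists (pt x); split=> [k|]; first by rewrite subrr normr0 ltW.
    rewrite (le_trans _ (ler_wpDl (f_ge0 _ _) dN)) // mxE.
    by rewrite ler_pM2r ?invr_gt0 // ler_nat.
  exists (pt y); split=> [k|].
    rewrite !mxE -mulrBl normrM [X in _ * X]gtr0_norm ?invr_gt0 //.
    apply: le_trans dN; rewrite ler_pM2r ?invr_gt0 //.
    have [] := xy k; rewrite -!(ler_nat R) !natrD => xy1 xy2.
    by rewrite ler_norml; apply/andP; split; lra.
  by rewrite -cy (le_trans (c_le _ yN)) // lerDl ltW.
rewrite mxE divr_ge0 ?ler0n //= ler_pdivrMr // mul1r ler_nat -ltnS.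
exact: ltn_ord.
Qed.

(** At a cluster point of the almost fixed points no coordinate decreases, hence
    none changes, the sum being 1 on both sides. *)
Theorem brouwer_simplex (d : nat) (f : 'rV[R]_d -> 'I_d -> R) :
  (1 < d)%N -> (forall x i, 0 <= f x i) -> (forall x, \sum_i f x i = 1) ->
  (forall i, continuous (fun x => f x i)) ->
  exists x : 'rV[R]_d, forall i, f x i = x 0 i.
Proof.
move=> d_gt1 f_ge0 f_sum f_cont.
have /choice[x xP] : forall n : nat, exists x : 'rV[R]_d,
    [/\ forall i, 0 <= x 0 i <= 1, \sum_i x 0 i = 1 &
        forall i, exists y : 'rV[R]_d,
          (forall k, `|x 0 k - y 0 k| <= n.+1%:R^-1) /\
          y 0 i <= f y i + n.+1%:R^-1].
  by move=> n; apply: simplex_almost_fixed.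
pose box := [set v : 'rV[R]_d | forall i, `[0, 1]%classic (v ord0 i)].
pose plane := [set v : 'rV[R]_d | \sum_i v 0 i = 1].
have K_compact : compact (box `&` plane).
  apply: compact_closedI.
    apply: (@rV_compact R d (fun=> `[0, 1]%classic)) => i.
    exact: segment_compact.
  have -> : plane = (fun v : 'rV[R]_d => \sum_i v 0 i) @^-1` [set 1] by [].
  apply: closed_comp; last exact: closed_eq.
  by move=> v _; apply: cont_sum => i _; apply: coord_continuous.
have [|p [[p_box p_plane] p_cl]] := K_compact (x @ \oo) _.
  exists 0%N => // n _ /=; by have [x01 x1 _] := xP n.
exists p; suff p_le i : p 0 i <= f p i.
  move=> i; apply: subr0_eq.
  apply: (@psumr_eq0P _ _ xpredT (fun i => f p i - p 0 i)) => //.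
    by move=> k _; rewrite subr_ge0.
  by rewrite big_split /= f_sum sumrN p_plane subrr.
rewrite leNgt; apply/negP => fp.
pose dl := (p 0 i - f p i) / 2.
have dl_gt0 : 0 < dl by rewrite divr_gt0 // subr_gt0.
have : nbhs p [set v : 'rV[R]_d | dl < v 0 i - f v i].
  have vcont : {for p, continuous (fun v : 'rV[R]_d => v 0 i - f v i)}.
    by apply: continuousB; [apply: coord_continuous|apply: f_cont].
  apply: (vcont [set z | dl < z]); apply: lt_nbhsr; rewrite /dl; lra.
move=> /nbhs_ballP[rho /= rho_gt0 rhoP].
pose n0 := Num.truncn (Num.min dl (rho / 2))^-1.
have mn_gt0 : 0 < Num.min dl (rho / 2) by rewrite lt_min dl_gt0 divr_gt0.
have n0P n : (n0 <= n)%N -> n.+1%:R^-1 < Num.min dl (rho / 2).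
  move=> n0n; rewrite invf_plt ?posrE ?ltr0n //.
  apply: lt_le_trans (truncnS_gt _) _.
  by rewrite ler_nat ltnS.
have [_ [[n n0n <-] xn]] : [set x n | n in [set n | n0 <= n]%N] `&` ball p (rho / 2) !=set0.
  apply: p_cl; last by apply: nbhsx_ballx; rewrite divr_gt0.
  by exists n0 => // n /= n0n; exists n.
have [_ _ /(_ i)[y [xy yf]]] := xP n.
have /andP[n_dl n_rho] : (n.+1%:R^-1 < dl) && (n.+1%:R^-1 < rho / 2).
  by have := n0P _ n0n; rewrite lt_min.
have : dl < y 0 i - f y i.
  apply: rhoP; apply: (@ball_split _ _ (x n)) => //.
  split=> [|j k]; first by rewrite divr_gt0.
  by rewrite /ball /= (ord1 j); apply: le_lt_trans (xy k) n_rho.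
by rewrite ltNge lerBlDl (le_trans yf) // lerD2l ltW.
Qed.

(** Continuity for the product topology on [Y -> R], tested on families of
    functions with continuous coordinates, so that it can be checked one
    coordinate at a time. *)
Definition family_continuous (Y : finType) (F : (Y -> R) -> Y -> R) : Prop :=
  forall (S : topologicalType) (w : S -> Y -> R),
    (forall y, continuous (fun s => w s y)) ->
    forall y, continuous (fun s => F (w s) y).

(** The cube containing the image is embedded in a simplex of the next dimension:
    its coordinates, shifted to be nonnegative and scaled down, have sum at most
    1, and the missing mass is the additional coordinate. *)
Theorem brouwer_bounded (Y : finType) (F : (Y -> R) -> Y -> R) (B : R) :
  family_continuous F -> (forall u y, `|F u y| <= B) -> exists u, F u = u.
Proof.
move=> F_cont F_le.
have [Y0|Y_gt0] := posnP #|Y|.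
  exists (fun=> 0); apply/funext => y.
  by have := fintype0 y; rewrite Y0; case: (Y0).
pose s := 2 * (`|B| + 1) * #|Y|%:R.
have Y_gt0R : 0 < #|Y|%:R :> R by rewrite ltr0n.
have B1 : 0 < 2 * (`|B| + 1) by rewrite mulr_gt0 // ltr_wpDl.
have s_gt0 : 0 < s by rewrite mulr_gt0.
pose u (v : 'rV[R]_#|Y|.+1) (y : Y) := s * v 0 (lift ord0 (enum_rank y)) - (`|B| + 1).
pose G v y := (F (u v) y + (`|B| + 1)) / s.
pose f v (i : 'I_#|Y|.+1) :=
  if unlift ord0 i is Some k then G v (enum_val k) else 1 - \sum_y G v y.
have G01 v y : 0 <= G v y <= #|Y|%:R^-1.
  have := F_le (u v) y; rewrite ler_norml => /andP[Fl Fr].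
  have := ler_norm B => Bn; rewrite divr_ge0 ?(ltW s_gt0) //=; last lra.
  rewrite ler_pdivrMr //.
  have -> : #|Y|%:R^-1 * s = 2 * (`|B| + 1) by rewrite /s; field; rewrite gt_eqF.
  lra.
have G_cont y : continuous (fun v => G v y).
  apply: contM; last exact: cst_continuous.
  apply: contD; last exact: cst_continuous.
  apply: (F_cont _ u) => {}y; apply: contB; last exact: cst_continuous.
  by apply: contM; [exact: cst_continuous|exact: coord_continuous].
have sumf v (h : 'I_#|Y|.+1 -> R) : h ord0 = 1 - \sum_y h (lift ord0 (enum_rank y)) ->
  \sum_i h i = 1.
  move=> h0; rewrite big_ord_recl h0 (reindex enum_rank) /= ?subrK //.
  by apply: onW_bij; apply: enum_rank_bij.
have [||v||v vE] := @brouwer_simplex _ f.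
- by rewrite ltnS.
- move=> v i; rewrite /f; case: unliftP => [k _|_].
    by have /andP[] := G01 v (enum_val k).
  rewrite subr_ge0; apply: le_trans (_ : \sum_(y : Y) #|Y|%:R^-1 <= 1).
    by apply: ler_sum => y _; have /andP[] := G01 v y.
  by rewrite sumr_const -(mulr_natr _^-1) mulVf ?gt_eqF.
- apply: sumf => //; rewrite /f unlift_none; congr (1 - _).
  by apply: eq_bigr => y _; rewrite liftK enum_rankK.
- move=> i; rewrite /f; case: unliftP => [k _|_]; first exact: G_cont.
  apply: contB; first exact: cst_continuous.
  by apply: cont_sum => y _; apply: G_cont.
exists (u v); apply/funext => y; rewrite {2}/u -vE /f liftK enum_rankK /G.
by field; rewrite gt_eqF.
Qed.

End Brouwer.

(** * Slopes on a network *)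

(* A pair of an edge [j] and a boolean [b] is the end [vend j b] of [j], with
   [true] for the start; [s j b] is the slope of a function [u] at that end, in the
   direction that leaves the end. *)
Section HalfEdges.
Context {R : realType} {I J : finType}.
Variables (vend : J -> bool -> I) (len nu : J -> R).
Hypotheses (len_gt0 : forall j, 0 < len j) (nu_gt0 : forall j, 0 < nu j).

Let T := \sum_(e : J * bool) nu e.1.

Let T_ge0 : 0 <= T. Proof. by apply: sumr_ge0 => e _; apply: ltW. Qed.

(** As the weighted sum of the slopes at a vertex is bounded below, none of them is
    very negative if none is very large. *)
Lemma kirchhoff_lower (c K : R) (s : J -> bool -> R) j b : 0 <= K ->
  - c <= \sum_(e : J * bool | vend e.1 e.2 == vend j b) nu e.1 * s e.1 e.2 ->
  (forall k b', vend k b' = vend j b -> s k b' <= K) ->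
  - ((c + T * K) / nu j) <= s j b.
Proof.
move=> K_ge0; rewrite (bigD1 (j, b)) //= => c_le s_le.
set P := fun e : J * bool => (vend e.1 e.2 == vend j b) && (e != (j, b)).
have rest : \sum_(e | P e) nu e.1 * s e.1 e.2 <= T * K.
  apply: (@le_trans _ _ (\sum_(e | P e) nu e.1 * K)).
    by apply: ler_sum => e /andP[/eqP ei _]; rewrite ler_pM2l // s_le.
  rewrite -mulr_suml ler_wpM2r // /T [leRHS](bigID P) /= lerDl.
  by apply: sumr_ge0 => e _; apply: ltW.
by rewrite -mulNr ler_pdivrMr // mulrC; move: c_le rest; rewrite /P; lra.
Qed.

(** The first two hypotheses on [s] express that [u] is semiconvex on the edges:
    leaving an end with slope [s j b], it arrives at the other end with slope at least
    [s j b - a].  The upper bound goes by induction on the number of vertices where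
    [u] is larger than at the given end.  If [s j b > a], then [u] is larger at the
    other end, the induction hypothesis bounds the slopes leaving it, and
    the lower bound of their sum bounds the slope with which [u] arrives there. *)
Lemma outward_slope_bound (a c : R) : 0 <= a -> 0 <= c ->
  exists K, 0 <= K /\ forall (u : I -> R) (s : J -> bool -> R),
    (forall j b, s j b + s j (~~ b) <= a) ->
    (forall j b, len j * (s j b - a) <= u (vend j (~~ b)) - u (vend j b)) ->
    (forall i, - c <= \sum_(e : J * bool | vend e.1 e.2 == i) nu e.1 * s e.1 e.2) ->
    forall j b, `|s j b| <= K.
Proof.
move=> a_ge0 c_ge0.
pose hyps (u : I -> R) (s : J -> bool -> R) :=
  [/\ forall j b, s j b + s j (~~ b) <= a,
      forall j b, len j * (s j b - a) <= u (vend j (~~ b)) - u (vend j b) &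
      forall i, - c <= \sum_(e : J * bool | vend e.1 e.2 == i) nu e.1 * s e.1 e.2].
pose L K := \sum_j (c + T * K) / nu j.
have L_le K j : 0 <= K -> 0 <= (c + T * K) / nu j <= L K.
  move=> K_ge0; have cTK k : 0 <= (c + T * K) / nu k.
    by rewrite divr_ge0 ?(ltW (nu_gt0 k)) // addr_ge0 ?mulr_ge0.
  by rewrite cTK /L (bigD1 j) //= lerDl sumr_ge0.
have L_ge0 K : 0 <= K -> 0 <= L K.
  move=> K_ge0; apply: sumr_ge0 => j _.
  by have /andP[] := L_le K j K_ge0.
have upper r : exists K, 0 <= K /\ forall u s, hyps u s -> forall j b,
    (#|[pred i | (u (vend j b) < u i)%R]| < r)%N -> s j b <= K.
  elim: r => [|r [K [K_ge0 IHr]]]; first by exists 0; split=> // u s _ j b.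
  exists (a + L K); split=> [|u s us j b card_r]; first by rewrite addr_ge0 ?L_ge0.
  have [su slen sK] := us; have /andP[L1 L2] := L_le K j K_ge0.
  have [s_le|s_gt] := leP (s j b) a; first by rewrite (le_trans s_le) // lerDl L_ge0.
  have uj : u (vend j b) < u (vend j (~~ b)).
    by rewrite -subr_gt0; apply: lt_le_trans (slen j b); rewrite mulr_gt0 // subr_gt0.
  have low := kirchhoff_lower K_ge0 (sK (vend j (~~ b))).
  have := su j b; suff : - ((c + T * K) / nu j) <= s j (~~ b) by lra.
  apply: low => k b' ki; apply: (IHr u s) => //; rewrite ki.
  apply: leq_trans (_ : #|[pred i' | (u (vend j b) < u i')%R]| <= r)%N => //.
  apply: proper_card; apply/properP; split.
    by apply/fintype.subsetP => i'; rewrite !inE; apply: lt_trans.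
  by exists (vend j (~~ b)); rewrite !inE ?ltxx.
have [K [K_ge0 KP]] := upper #|I|.+1.
exists (K + L K); split=> [|u s su slen sK j b]; first by rewrite addr_ge0 ?L_ge0.
have s_le k b' : s k b' <= K.
  by apply: (KP u s) => //; rewrite ltnS max_card.
have /andP[L1 L2] := L_le K j K_ge0.
have low := kirchhoff_lower K_ge0 (sK (vend j b)) (fun k b' _ => s_le k b').
by rewrite ler_norml; apply/andP; split; have := s_le j b; lra.
Qed.

End HalfEdges.

Section Edge.
Context {R : realType}.

Lemma semi_increasing (p : nat -> R) (N : nat) (d : R) :
  (forall k, (1 <= k < N)%N -> - d <= p k - p k.-1) ->
  forall m k, (m <= k < N)%N -> p m - (k - m)%:R * d <= p k.
Proof.
move=> p_incr m k /andP[/subnK <-]; move: (k - m)%N => i.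
elim: i => [|i IHi] iN; first by rewrite subnn mul0r subr0.
rewrite -[leLHS]/(p m - ((i + m).+1 - m)%:R * d).
have := IHi (ltnW iN); rewrite addnK -addSn addnK -natr1 mulrDl mul1r => pi.
have := p_incr (i + m).+1; rewrite iN /= => /(_ isT) /=.
rewrite addSn; lra.
Qed.

End Edge.

Section Network.
Context {R : realType} {n : nat} {I J : finType}.
Variables (G : network_data R n I J) (HG : is_network G).

Lemma arc_ends : exists st en : J -> I,
  (forall i j, (j \in incp G i) = (i == st j)) /\
  (forall i j, (j \in incm G i) = (i == en j)).
Proof.
have /choice[st stP] := arc_start HG; have /choice[en enP] := arc_end HG.
exists st, en; split=> i j.
  have := stP j; rewrite !inE => /eqP <-.
  exact: (inj_eq (vtx_inj HG)).
have := enP j; rewrite !inE => /eqP <-.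
exact: (inj_eq (vtx_inj HG)).
Qed.

Variables (st en : J -> I).
Hypothesis stP : forall i j, (j \in incp G i) = (i == st j).
Hypothesis enP : forall i j, (j \in incm G i) = (i == en j).

Lemma sum_incp (F : I -> J -> R) :
  \sum_i \sum_(j in incp G i) F i j = \sum_j F (st j) j.
Proof.
rewrite (exchange_big_dep xpredT) //=; apply: eq_bigr => j _.
by rewrite (big_pred1 (st j)) // => i; rewrite stP.
Qed.

Lemma sum_incm (F : I -> J -> R) :
  \sum_i \sum_(j in incm G i) F i j = \sum_j F (en j) j.
Proof.
rewrite (exchange_big_dep xpredT) //=; apply: eq_bigr => j _.
by rewrite (big_pred1 (en j)) // => i; rewrite enP.
Qed.

Lemma vertex_incident i : exists j, (i == st j) || (i == en j).
Proof.
have /card_gt0P[j0 _] := has_edge HG.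
have [->|i_st] := eqVneq i (st j0); first by exists j0; rewrite eqxx.
have /connectP[[|i' p] /= pth lst] := graph_connected HG i (st j0).
  by rewrite -lst eqxx in i_st.
move: pth => /andP[/existsP[j /andP[+ _]] _].
by rewrite finset.in_setU stP enP => ji; exists j.
Qed.

Lemma vertex_oscillation (D : R) : 0 <= D -> forall u : I -> R,
  (forall j, `|u (st j) - u (en j)| <= D) ->
  forall i i', `|u i - u i'| <= #|I|%:R * D.
Proof.
move=> D_ge0 u uD i i'.
have adj k k' : adjacent G k k' -> `|u k - u k'| <= D.
  move=> /existsP[j]; rewrite !finset.in_setU !stP !enP => /andP[].
  by move=> /orP[]/eqP-> /orP[]/eqP->; rewrite ?subrr ?normr0 // distrC.
have /connectP[p pth ->] := graph_connected HG i i'.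
case/shortenP: pth => q pth q_uniq _.
have q_size : (size q <= #|I|)%N.
  by apply: ltnW; have /card_uniqP/= <- := q_uniq; apply: max_card.
apply: (@le_trans _ _ ((size q)%:R * D)); last by rewrite ler_wpM2r // ler_nat.
elim: q i pth {q_uniq q_size} => [|k q IHq] i /=.
  by rewrite subrr normr0 mul0r.
move=> /andP[/adj ik /IHq kq]; rewrite -natr1 mulrDl mul1r [leRHS]addrC.
rewrite -(subrK (u k) (u i)) -addrA; exact: le_trans (ler_normD _ _) (lerD _ _).
Qed.

Section Grid.
Variables (h : J -> R) (h_adm : admissible G h).

Local Notation N := (nsteps G h).

Lemma step_gt0 j : 0 < h j. Proof. by have [] := h_adm j. Qed.
Lemma nsteps_gt1 j : (1 < N j)%N. Proof. by have [] := h_adm j. Qed.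
Lemma nsteps_gt0 j : (0 < N j)%N. Proof. exact: ltnW (nsteps_gt1 j). Qed.

Lemma nstepsM j : (N j)%:R * h j = len G j.
Proof.
have [h_gt0 hN _] := h_adm j.
by rewrite /nsteps truncnK // divfK // gt_eqF.
Qed.

Lemma grid_point j k : (k <= N j)%N -> 0 <= k%:R * h j <= len G j.
Proof.
move=> kN; rewrite mulr_ge0 ?ler0n ?(ltW (step_gt0 j)) //=.
by rewrite -nstepsM ler_pM2r ?step_gt0 // ler_nat.
Qed.

Lemma step_le j : h j <= len G j.
Proof. by have := @grid_point j 1 (nsteps_gt0 j); rewrite mul1r => /andP[]. Qed.

Variable U : grid_fun G h.

Lemma dd2E j k : (0 < k)%N ->
  dd2 U j k = (dplus U j k - dplus U j k.-1) / h j.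
Proof.
case: k => // k _; rewrite /dd2 /dplus /=; field.
by rewrite gt_eqF ?step_gt0.
Qed.

Lemma gval_dplus j k : gval U j k - gval U j 0 = \sum_(0 <= i < k) h j * dplus U j i.
Proof.
rewrite -(telescope_sumr (gval U j) (leq0n k)); apply: eq_bigr => i _.
by rewrite /dplus mulrC divfK // gt_eqF ?step_gt0.
Qed.

Lemma grid_max : exists j k, (k <= N j)%N /\
  forall j' k', (k' <= N j')%N -> gval U j' k' <= gval U j k.
Proof.
have /card_gt0P[j0 _] := has_edge HG.
pose F (x : {j : J & 'I_(N j).+1}) := @U (tag x) (tagged x).
have [x _ x_max] := @arg_maxP _ _ _ (Tagged (fun j => 'I_(N j).+1) (ord0 : 'I_(N j0).+1))
  xpredT F isT.
exists (tag x), (tagged x); split=> [|j k kN]; first by rewrite -ltnS.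
by rewrite {2}/gval inord_val; apply: (x_max (Tagged _ (inord k))).
Qed.

Lemma gval_increment_le (K : R) : (forall j k, (k < N j)%N -> `|dplus U j k| <= K) ->
  forall j k, (k <= N j)%N -> `|gval U j k - gval U j 0| <= len G j * K.
Proof.
move=> pK j k kN; rewrite gval_dplus.
have K_ge0 : 0 <= K := le_trans (normr_ge0 _) (pK j 0%N (nsteps_gt0 j)).
apply: le_trans (ler_norm_sum _ _ _) _.
apply: (@le_trans _ _ (\sum_(0 <= i < k) h j * K)).
  rewrite big_nat [leRHS]big_nat; apply: ler_sum => i /= ik.
  rewrite normrM (gtr0_norm (step_gt0 j)) ler_pM2l ?step_gt0 // pK //.
  exact: leq_trans ik kN.
rewrite sumr_const_nat subn0 -mulr_natl mulrA ler_wpM2r //.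
by have /andP[] := grid_point kN.
Qed.

End Grid.
End Network.

Section Network.
Context {R : realType} {n : nat} {I J : finType}.
Variables (G : network_data R n I J) (HG : is_network G).
Variables (st en : J -> I).
Hypothesis stP : forall i j, (j \in incp G i) = (i == st j).
Hypothesis enP : forall i j, (j \in incm G i) = (i == en j).
Variables (nu : J -> R).
Hypothesis nu_gt0 : forall j, 0 < nu j.

Definition vertex_values h (U : grid_fun G h) (u : I -> R) : Prop :=
  forall j, gval U j 0 = u (st j) /\ gval U j (nsteps G h j) = u (en j).

Definition flux h (U : grid_fun G h) (i : I) : R :=
  \sum_(j in incp G i) nu j * dplus U j 0
  - \sum_(j in incm G i) nu j * dplus U j (nsteps G h j).-1.

(** The outward slopes at the vertices control the whole edge: the slope can only
    drop by a bounded amount along it, so that it is bounded below in terms of the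
    first slope and above in terms of the last one. *)
Lemma gradient_bound (c : R) : 0 <= c ->
  exists K, 0 <= K /\ forall h, admissible G h ->
    forall (U : grid_fun G h) (u : I -> R), vertex_values U u ->
    (forall j k, (1 <= k < nsteps G h j)%N -> - c <= nu j * dd2 U j k) ->
    (forall i, - c <= flux U i) ->
    forall j k, (k < nsteps G h j)%N -> `|dplus U j k| <= K.
Proof.
move=> c_ge0; pose a := \sum_j c * len G j / nu j.
have a_j j : 0 <= c * len G j / nu j <= a.
  have a_j k : 0 <= c * len G k / nu k.
    by rewrite divr_ge0 ?(ltW (nu_gt0 k)) // mulr_ge0 // ltW // (len_gt0 HG).
  by rewrite a_j /a (bigD1 j) //= lerDl sumr_ge0.
have a_ge0 : 0 <= a by apply: sumr_ge0 => j _; have /andP[] := a_j j.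
clearbody a.
pose vend (j : J) (b : bool) := if b then st j else en j.
have [K [K_ge0 KP]] := @outward_slope_bound R I J vend _ nu (len_gt0 HG) nu_gt0 a c a_ge0 c_ge0.
exists (K + a); split=> [|h h_adm U u uU Ucvx Ukir j k kN]; first by rewrite addr_ge0.
pose N := nsteps G h.
have p_incr i m l : (m <= l < N i)%N -> dplus U i m - a <= dplus U i l.
  move=> ml; have d_ge0 : 0 <= c * h i / nu i.
    by rewrite divr_ge0 ?(ltW (nu_gt0 i)) // mulr_ge0 // ltW // (step_gt0 h_adm).
  apply: le_trans (@semi_increasing _ _ (N i) (c * h i / nu i) _ m l ml).
    rewrite lerD2l lerN2; apply: (@le_trans _ _ ((N i)%:R * (c * h i / nu i))).
      by rewrite ler_wpM2r // ler_nat; lia.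
    have /andP[_] := a_j i; rewrite -(nstepsM h_adm i) -/N; apply: le_trans.
    by rewrite le_eqVlt; apply/orP; left; apply/eqP; ring.
  move=> q qN; have := Ucvx i q qN; rewrite (dd2E h_adm) ?(andP qN).1 //.
  have hnu : 0 <= h i / nu i by rewrite divr_ge0 // ltW // (step_gt0 h_adm).
  move=> /(ler_wpM2r hnu); congr (_ <= _); first by rewrite mulNr mulrA.
  by field; rewrite !gt_eqF // (step_gt0 h_adm).
pose s j (b : bool) := if b then dplus U j 0 else - dplus U j (N j).-1.
have N_gt0 i : (0 < N i)%N := nsteps_gt0 h_adm i.
have Npred i : ((N i).-1 < N i)%N by rewrite prednK.
have sK : forall j b, `|s j b| <= K.
  apply: (KP u) => [i b|i b|i].
  - have := p_incr i 0%N (N i).-1; rewrite /= Npred => /(_ isT).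
    by case: b; rewrite /s /=; lra.
  - have [u0 uN] := uU i; have := gval_dplus h_adm U i (N i); rewrite u0 uN.
    have sumE (x : R) : len G i * x = \sum_(0 <= q < N i) h i * x.
      by rewrite sumr_const_nat subn0 -mulr_natl mulrA nstepsM.
    case: b; rewrite /vend /s /= => Usum.
      rewrite Usum sumE; apply: ler_sum_nat => q /= qN.
      by rewrite ler_pM2l ?(step_gt0 h_adm) // p_incr.
    rewrite -[leRHS]opprB Usum sumE -sumrN; apply: ler_sum_nat => q /= qN.
    rewrite -[leRHS]mulrN ler_pM2l ?(step_gt0 h_adm) //.
    have := p_incr i q (N i).-1; rewrite Npred andbT -ltnS prednK // qN.
    by move=> /(_ isT); lra.
  - apply: le_trans (Ukir i) _; rewrite /flux /=.
    rewrite [leRHS]big_mkcond -(pair_bigA _ (fun j b =>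
      if vend j b == i then nu j * s j b else 0)) /=.
    under [leRHS]eq_bigr do rewrite big_bool /=.
    rewrite big_split /= -!big_mkcond /= /vend /s -sumrN.
    rewrite (eq_bigl (fun j => st j == i)) => [|q]; last by rewrite stP eq_sym.
    rewrite lerD2l [leLHS](eq_bigl (fun j => en j == i)) => [|q]; last by rewrite enP eq_sym.
    by apply: ler_sum => q _; rewrite mulrN.
have := sK j true; have := sK j false; rewrite /s !ler_norml => /andP[e1 e2] /andP[s1 s2].
apply/andP; split.
  by have := p_incr j 0%N k; rewrite kN => /(_ isT); lra.
by have := p_incr j k (N j).-1; rewrite Npred andbT -ltnS prednK // kN => /(_ isT); lra.
Qed.

Lemma grid_oscillation (K : R) h : admissible G h ->
  forall (U : grid_fun G h) (u : I -> R), vertex_values U u ->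
  (forall j k, (k < nsteps G h j)%N -> `|dplus U j k| <= K) ->
  forall j k j' k', (k <= nsteps G h j)%N -> (k' <= nsteps G h j')%N ->
  `|gval U j k - gval U j' k'| <= (#|I|.+2)%:R * ((\sum_i len G i) * K).
Proof.
move=> h_adm U u uU pK j k j' k' kN k'N.
have K_ge0 : 0 <= K := le_trans (normr_ge0 _) (pK j 0%N (nsteps_gt0 h_adm j)).
pose L := \sum_i len G i.
have len_L i : len G i <= L.
  by rewrite /L (bigD1 i) //= lerDl sumr_ge0 // => q _; rewrite ltW // (len_gt0 HG).
have L_ge0 : 0 <= L by apply: le_trans (len_L j); rewrite ltW // (len_gt0 HG).
have inc_le i q : (q <= nsteps G h i)%N -> `|gval U i q - u (st i)| <= L * K.
  move=> qN; have [<- _] := uU i.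
  by apply: le_trans (gval_increment_le h_adm pK qN) _; rewrite ler_wpM2r.
have u_le : `|u (st j) - u (st j')| <= #|I|%:R * (L * K).
  apply: (vertex_oscillation HG stP enP); first by rewrite mulr_ge0.
  by move=> i; rewrite distrC; have [_ <-] := uU i; apply: inc_le.
have := inc_le j k kN; have := inc_le j' k' k'N.
rewrite -2!natr1 !mulrDl !mul1r; move: u_le; rewrite !ler_norml.
move: (#|I|%:R * (L * K)) (L * K) => Z X.
by move=> /andP[a1 a2] /andP[b1 b2] /andP[c1 c2]; apply/andP; split; lra.
Qed.

End Network.

(** * A priori bounds for the Hamilton-Jacobi equation *)

Section Network.
Context {R : realType} {n : nat} {I J : finType}.
Variables (G : network_data R n I J) (HG : is_network G).
Variables (st en : J -> I).
Hypothesis stP : forall i j, (j \in incp G i) = (i == st j).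
Hypothesis enP : forall i j, (j \in incm G i) = (i == en j).
Variables (nu : J -> R).
Hypothesis nu_gt0 : forall j, 0 < nu j.

Definition load h (W : grid_fun G h) (i : I) : R :=
  \sum_(j in incp G i) h j / 2 * gval W j 0
  + \sum_(j in incm G i) h j / 2 * gval W j (nsteps G h j).

Definition weight (h : J -> R) (i : I) : R :=
  \sum_(j in incp G i) h j / 2 + \sum_(j in incm G i) h j / 2.

Lemma SopE h (U W : grid_fun G h) i : Sop nu U W i = flux nu U i + load W i.
Proof.
by rewrite /Sop big_split /= sumrB /flux /load; ring.
Qed.

Lemma weight_gt0 h i : admissible G h -> 0 < weight h i.
Proof.
move=> h_adm; have h2 j : 0 < h j / 2 by rewrite divr_gt0 // (step_gt0 h_adm).
have [j ij] := vertex_incident HG stP enP i.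
have sum_ge0 (A : {set J}) : 0 <= \sum_(j in A) h j / 2.
  by apply: sumr_ge0 => k _; apply: ltW.
have sum_gt0 (A : {set J}) : j \in A -> 0 < \sum_(j in A) h j / 2.
  move=> jA; rewrite (bigD1 j) //= ltr_wpDr // sumr_ge0 // => k _; exact: ltW.
case/orP: ij => ij.
  by apply: ltr_wpDr (sum_gt0 _ _); rewrite ?stP.
by apply: ltr_wpDl (sum_gt0 _ _); rewrite ?enP.
Qed.


Lemma load_cst h (W : grid_fun G h) (a : R) i :
  load (gsub W (gcst a)) i = load W i - weight h i * a.
Proof.
rewrite /load /weight mulrDl opprD addrACA !mulr_suml -!sumrB.
by congr (_ + _); apply: eq_bigr => j _; rewrite -mulrBr.
Qed.

Lemma load_le h (W : grid_fun G h) (b : R) i : admissible G h ->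
  (forall j k, (k <= nsteps G h j)%N -> `|gval W j k| <= b) ->
  `|load W i| <= weight h i * b.
Proof.
move=> h_adm Wb; have h2 j : 0 < h j / 2 by rewrite divr_gt0 // (step_gt0 h_adm).
rewrite /weight mulrDl !mulr_suml; apply: le_trans (ler_normD _ _) _.
apply: lerD; apply: le_trans (ler_norm_sum _ _ _) _; apply: ler_sum => j _;
  by rewrite normrM gtr0_norm // ler_pM2l // Wb.
Qed.

Lemma weight_le h i : admissible G h -> weight h i <= \sum_j len G j.
Proof.
move=> h_adm; have h2 j : 0 < h j / 2 by rewrite divr_gt0 // (step_gt0 h_adm).
have half (A : {set J}) : \sum_(j in A) h j / 2 <= \sum_j h j / 2.
  by rewrite [leRHS](bigID (mem A)) /= lerDl sumr_ge0 // => j _; apply: ltW.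
apply: le_trans (lerD (half _) (half _)) _; rewrite -big_split /=.
by apply: ler_sum => j _; have := step_le h_adm j; lra.
Qed.

Section Flux.
Variables (h : J -> R) (h_adm : admissible G h).
Variables (U : grid_fun G h) (u : I -> R) (i : I).
Hypothesis uU : vertex_values st en U u.

Let dplus_start j : j \in incp G i -> dplus U j 0 = (gval U j 1 - u i) / h j.
Proof. by rewrite stP => /eqP ->; rewrite -(uU j).1. Qed.

Let dplus_end j : j \in incm G i ->
  dplus U j (nsteps G h j).-1 = (u i - gval U j (nsteps G h j).-1) / h j.
Proof.
by rewrite enP => /eqP ->; rewrite -(uU j).2 /dplus prednK ?(nsteps_gt0 h_adm).
Qed.

Lemma flux_max : (forall j k, (k <= nsteps G h j)%N -> gval U j k <= u i) ->
  flux nu U i <= 0.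
Proof.
move=> u_max; rewrite subr_le0 (@le_trans _ _ 0) //.
  apply: sumr_le0 => j /dplus_start ->; rewrite pmulr_rle0 //.
  rewrite pmulr_lle0 ?invr_gt0 ?(step_gt0 h_adm) // subr_le0.
  by apply: u_max; apply: (nsteps_gt0 h_adm).
apply: sumr_ge0 => j /dplus_end ->; rewrite pmulr_rge0 //.
rewrite pmulr_lge0 ?invr_gt0 ?(step_gt0 h_adm) // subr_ge0.
by apply: u_max; apply: leq_pred.
Qed.

Lemma flux_min : (forall j k, (k <= nsteps G h j)%N -> u i <= gval U j k) ->
  0 <= flux nu U i.
Proof.
move=> u_min; rewrite subr_ge0 (@le_trans _ _ 0) //.
  apply: sumr_le0 => j /dplus_end ->; rewrite pmulr_rle0 //.
  rewrite pmulr_lle0 ?invr_gt0 ?(step_gt0 h_adm) // subr_le0.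
  by apply: u_min; apply: leq_pred.
apply: sumr_ge0 => j /dplus_start ->; rewrite pmulr_rge0 //.
rewrite pmulr_lge0 ?invr_gt0 ?(step_gt0 h_adm) // subr_ge0.
by apply: u_min; apply: (nsteps_gt0 h_adm).
Qed.

End Flux.

Section Extremum.
Variables (h : J -> R) (h_adm : admissible G h) (U : grid_fun G h).

Lemma interior_max j k : (1 <= k < nsteps G h j)%N ->
  (forall q, (q <= nsteps G h j)%N -> gval U j q <= gval U j k) ->
  [/\ dplus U j k <= 0, 0 <= dplus U j k.-1 & dd2 U j k <= 0].
Proof.
move=> /andP[k_gt0 kN] k_max; have h_gt0 := step_gt0 h_adm j.
have p1 : dplus U j k <= 0.
  by rewrite pmulr_lle0 ?invr_gt0 // subr_le0 k_max.
have p2 : 0 <= dplus U j k.-1.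
  rewrite pmulr_lge0 ?invr_gt0 // subr_ge0 prednK // k_max //.
  exact: leq_trans (leq_pred _) (ltnW kN).
split=> //; rewrite (dd2E h_adm) // pmulr_lle0 ?invr_gt0 //; lra.
Qed.

Lemma interior_min j k : (1 <= k < nsteps G h j)%N ->
  (forall q, (q <= nsteps G h j)%N -> gval U j k <= gval U j q) ->
  [/\ 0 <= dplus U j k, dplus U j k.-1 <= 0 & 0 <= dd2 U j k].
Proof.
move=> /andP[k_gt0 kN] k_min; have h_gt0 := step_gt0 h_adm j.
have p1 : 0 <= dplus U j k.
  by rewrite pmulr_lge0 ?invr_gt0 // subr_ge0 k_min.
have p2 : dplus U j k.-1 <= 0.
  rewrite pmulr_lle0 ?invr_gt0 // subr_le0 prednK // k_min //.
  exact: leq_trans (leq_pred _) (ltnW kN).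
split=> //; rewrite (dd2E h_adm) // pmulr_lge0 ?invr_gt0 //; lra.
Qed.

Lemma grid_min : exists j k, (k <= nsteps G h j)%N /\
  forall j' k', (k' <= nsteps G h j')%N -> gval U j k <= gval U j' k'.
Proof.
have [j [k [kN k_max]]] := grid_max HG (fun j k => - @U j k : R).
by exists j, k; split=> // j' k' /(k_max j'); rewrite /gval lerN2.
Qed.

End Extremum.

Variable g : J -> R -> R -> R -> R.

Definition hjb_residual h (U W : grid_fun G h) (Lambda : R) j k : R :=
  - nu j * dd2 U j k + along g U j k + Lambda - gval W j k.

(** The equation for [U] with obstacles at [- r] and [r].  These are the conditions
    satisfied by a fixed point of the truncated explicit step, and by a solution
    when [r] exceeds its norm.  The last two fields exclude that a constant equal to
    an obstacle hides the value of [Lambda]. *)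
Record relaxed_solution (r : R) h (U : grid_fun G h) (u : I -> R)
    (W : grid_fun G h) (Lambda : R) : Prop := RelaxedSolution {
  relaxed_vertex_values : vertex_values st en U u;
  relaxed_bound : forall j k, (k <= nsteps G h j)%N -> - r <= gval U j k <= r;
  relaxed_interior : forall j k, (1 <= k < nsteps G h j)%N ->
    (- r < gval U j k -> hjb_residual U W Lambda j k <= 0) /\
    (gval U j k < r -> 0 <= hjb_residual U W Lambda j k);
  relaxed_vertex : forall i,
    (- r < u i -> 0 <= Sop nu U (gsub W (gcst Lambda)) i) /\
    (u i < r -> Sop nu U (gsub W (gcst Lambda)) i <= 0);
  relaxed_bottom :
    (forall j k, (k <= nsteps G h j)%N -> gval U j k = - r) -> Lambda <= 0;
  relaxed_top :
    (forall j k, (k <= nsteps G h j)%N -> gval U j k = r) -> 0 <= Lambda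
}.

Hypothesis g_mono : G1 G g.
Variables (B h0 Cg : R).
Hypotheses (B_ge0 : 0 <= B) (h0_ge0 : 0 <= h0) (Cg_ge0 : 0 <= Cg).
Hypothesis g_zero : forall j x, 0 <= x <= len G j -> `|g j x 0 0| <= h0.
Hypothesis g_lower : forall j x q1 q2, 0 <= x <= len G j -> - Cg <= g j x q1 q2.

Section Relaxed.
Variables (r : R) (h : J -> R) (h_adm : admissible G h).
Variables (U : grid_fun G h) (u : I -> R) (W : grid_fun G h) (Lambda : R).
Hypothesis rel : relaxed_solution r U u W Lambda.
Hypothesis W_le : forall j k, (k <= nsteps G h j)%N -> `|gval W j k| <= B.

Let uU := relaxed_vertex_values rel.

Lemma grid_node j k : (k <= nsteps G h j)%N ->
  (1 <= k < nsteps G h j)%N \/ exists i, gval U j k = u i.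
Proof.
move=> kN; have [->|k_gt0] := posnP k; first by right; exists (st j); rewrite (uU j).1.
have [kN'|kN'] := ltnP k (nsteps G h j); first by left.
by right; exists (en j); rewrite -(uU j).2; congr gval; apply/eqP; rewrite eqn_leq kN.
Qed.

(** At a maximum of [U] the differences entering [g] have the signs for which [g] is
    at least its value at [(0, 0)], and the other terms are nonnegative. *)
Lemma Lambda_le : Lambda <= B + h0.
Proof.
have [j [k [kN k_max]]] := grid_max HG U.
have /andP[Ur1 Ur2] := relaxed_bound rel kN.
have [Ur|Ur] := leP (gval U j k) (- r).
  apply: (@le_trans _ _ 0); last exact: addr_ge0.
  apply: (relaxed_bottom rel) => j' k' k'N; apply/eqP; rewrite eq_le.
  by rewrite (le_trans (k_max _ _ k'N)) //; have /andP[] := relaxed_bound rel k'N.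
have [kN'|[i Ui]] := grid_node kN.
  have [p1 p2 d2] := interior_max h_adm kN' (fun q => k_max j q).
  have [/(_ Ur) res _] := relaxed_interior rel kN'.
  have xk := grid_point h_adm kN.
  have := W_le kN; have := g_zero xk; rewrite !ler_norml => /andP[g1 _] /andP[_ w1].
  have gk : g j (k%:R * h j) 0 0 <= along g U j k.
    have [gq1 gq2] := g_mono xk.
    exact: le_trans (gq2 _ _ _ p2) (gq1 _ _ _ p1).
  have nd : 0 <= - nu j * dd2 U j k by rewrite mulNr -mulrN mulr_ge0 ?oppr_ge0 // ltW.
  move: res; rewrite /hjb_residual; lra.
have w_gt0 := weight_gt0 i h_adm.
have [+ _] := relaxed_vertex rel i; rewrite -Ui => /(_ Ur).
rewrite SopE load_cst => res.
have fl : flux nu U i <= 0.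
  by apply: (flux_max h_adm uU) => j' k' k'N; rewrite -Ui k_max.
have := load_le i h_adm W_le; rewrite ler_norml => /andP[_ ld].
suff : weight h i * Lambda <= weight h i * (B + h0) by rewrite ler_pM2l.
have : 0 <= weight h i * h0 by rewrite mulr_ge0 // ltW.
rewrite mulrDr; lra.
Qed.

Lemma Lambda_ge : - (B + h0) <= Lambda.
Proof.
have [j [k [kN k_min]]] := grid_min U.
have /andP[Ur1 Ur2] := relaxed_bound rel kN.
have [Ur|Ur] := leP r (gval U j k).
  apply: (@le_trans _ _ 0); first by rewrite oppr_le0 addr_ge0.
  apply: (relaxed_top rel) => j' k' k'N; apply/eqP; rewrite eq_le.
  by rewrite (le_trans Ur (k_min _ _ k'N)) andbT; have /andP[] := relaxed_bound rel k'N.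
have [kN'|[i Ui]] := grid_node kN.
  have [p1 p2 d2] := interior_min h_adm kN' (fun q => k_min j q).
  have [_ /(_ Ur) res] := relaxed_interior rel kN'.
  have xk := grid_point h_adm kN.
  have := W_le kN; have := g_zero xk; rewrite !ler_norml => /andP[_ g1] /andP[w1 _].
  have gk : along g U j k <= g j (k%:R * h j) 0 0.
    have [gq1 gq2] := g_mono xk.
    exact: le_trans (gq1 _ _ _ p1) (gq2 _ _ _ p2).
  have nd : 0 <= nu j * dd2 U j k by rewrite mulr_ge0 // ltW.
  move: res; rewrite /hjb_residual mulNr; lra.
have w_gt0 := weight_gt0 i h_adm.
have [_] := relaxed_vertex rel i; rewrite -Ui => /(_ Ur).
rewrite SopE load_cst => res.
have fl : 0 <= flux nu U i.
  by apply: (flux_min h_adm uU) => j' k' k'N; rewrite -Ui k_min.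
have := load_le i h_adm W_le; rewrite ler_norml => /andP[ld _].
suff : weight h i * - (B + h0) <= weight h i * Lambda by rewrite ler_pM2l.
have : 0 <= weight h i * h0 by rewrite mulr_ge0 // ltW.
rewrite mulrN mulrDr; lra.
Qed.

(** Where [U] touches the lower obstacle, it has a minimum and the second difference
    is nonnegative; elsewhere the equation holds as an inequality, which is the
    required one since [g] is bounded below. *)
Lemma relaxed_semiconvex j k : (1 <= k < nsteps G h j)%N ->
  - (B + Cg + (B + h0)) <= nu j * dd2 U j k.
Proof.
move=> kN'; have kN : (k <= nsteps G h j)%N by lia.
have /andP[Ur1 Ur2] := relaxed_bound rel kN.
have [Ur|Ur] := leP (gval U j k) (- r).
  have [||_ _ d2] := @interior_min h h_adm U j k => //.
    by move=> q /(relaxed_bound rel)/andP[q1 _]; apply: le_trans Ur q1.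
  apply: (@le_trans _ _ 0); first by rewrite oppr_le0 !addr_ge0.
  by rewrite mulr_ge0 // ltW.
have [/(_ Ur) res _] := relaxed_interior rel kN'.
have xk := grid_point h_adm kN.
have gk : - Cg <= along g U j k := g_lower _ _ xk.
have := W_le kN; rewrite !ler_norml => /andP[_ w1].
by move: res Lambda_ge; rewrite /hjb_residual mulNr; lra.
Qed.

Lemma relaxed_kirchhoff i :
  - ((\sum_j len G j) * (B + (B + h0))) <= flux nu U i.
Proof.
have L_ge0 : 0 <= \sum_j len G j.
  by apply: sumr_ge0 => j _; rewrite ltW // (len_gt0 HG).
have [Ur|Ur] := leP (u i) (- r).
  apply: (@le_trans _ _ 0); first by rewrite oppr_le0 mulr_ge0 // !addr_ge0.
  apply: (flux_min h_adm uU) => j k /(relaxed_bound rel)/andP[q1 _].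
  exact: le_trans Ur q1.
have [/(_ Ur) + _] := relaxed_vertex rel i.
rewrite SopE load_cst => res.
have := load_le i h_adm W_le; rewrite ler_norml => /andP[_ ld].
have w_gt0 := weight_gt0 i h_adm.
have wL := weight_le i h_adm.
have w1 : weight h i * (B + (B + h0)) <= (\sum_j len G j) * (B + (B + h0)).
  by rewrite ler_wpM2r // !addr_ge0.
have w2 : weight h i * - (B + h0) <= weight h i * Lambda.
  by rewrite ler_pM2l // Lambda_ge.
move: w1 w2; rewrite mulrN !mulrDr; lra.
Qed.

End Relaxed.

Lemma relaxed_apriori : exists K D, [/\ 0 <= K, 0 <= D &
  forall r h, admissible G h ->
  forall (U : grid_fun G h) u (W : grid_fun G h) Lambda,
    relaxed_solution r U u W Lambda ->
    (forall j k, (k <= nsteps G h j)%N -> `|gval W j k| <= B) ->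
  [/\ `|Lambda| <= B + h0,
      forall j k, (k < nsteps G h j)%N -> `|dplus U j k| <= K &
      forall j k j' k', (k <= nsteps G h j)%N -> (k' <= nsteps G h j')%N ->
        `|gval U j k - gval U j' k'| <= D]].
Proof.
pose L := \sum_j len G j.
have L_ge0 : 0 <= L by apply: sumr_ge0 => j _; rewrite ltW // (len_gt0 HG).
pose c := (B + Cg + (B + h0)) + L * (B + (B + h0)).
have c1_ge0 : 0 <= B + Cg + (B + h0) by rewrite !addr_ge0.
have c2_ge0 : 0 <= L * (B + (B + h0)) by rewrite mulr_ge0 // !addr_ge0.
have c_ge0 : 0 <= c by rewrite addr_ge0.
have [K [K_ge0 KP]] := gradient_bound HG stP enP nu_gt0 c_ge0.
exists K, ((#|I|.+2)%:R * (L * K)); split=> //; first by rewrite !mulr_ge0.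
move=> r h h_adm U u W Lambda rel W_le.
have pK : forall j k, (k < nsteps G h j)%N -> `|dplus U j k| <= K.
  apply: (KP h h_adm U u (relaxed_vertex_values rel)) => [j k kN|i].
    apply: le_trans (relaxed_semiconvex h_adm rel W_le kN).
    by rewrite lerN2 /c lerDl.
  apply: le_trans (relaxed_kirchhoff h_adm rel W_le i).
  by rewrite lerN2 /c lerDr.
split=> //; last exact: (grid_oscillation HG stP enP h_adm (relaxed_vertex_values rel)).
by rewrite ler_norml (Lambda_ge h_adm rel W_le) (Lambda_le h_adm rel W_le).
Qed.

End Network.

(** * Continuous grid functions and mass *)

Section Network.
Context {R : realType} {n : nat} {I J : finType}.
Variables (G : network_data R n I J) (HG : is_network G).
Variables (st en : J -> I).
Hypothesis stP : forall i j, (j \in incp G i) = (i == st j).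
Hypothesis enP : forall i j, (j \in incm G i) = (i == en j).
Variables (h : J -> R) (h_adm : admissible G h).

Local Notation N := (nsteps G h).
Local Notation grid := (grid_fun G h).

Lemma gval_ord (W : grid) j (k : 'I_(N j).+1) : gval W j k = W j k.
Proof. by rewrite /gval inord_val. Qed.

Lemma gridP (W W' : grid) :
  (forall j k, (k <= N j)%N -> gval W j k = gval W' j k) -> W = W'.
Proof.
move=> WW'; apply/functional_extensionality_dep => j; apply/funext => k.
by rewrite -!gval_ord WW' // -ltnS.
Qed.

(** Every function of this form is continuous at the vertices; this is how the grid
    functions produced by the fixed point map are built. *)
Definition assemble (a : I -> R) (b : J -> nat -> R) : grid := fun j k =>
  if k == 0%N :> nat then a (st j) else if k == N j :> nat then a (en j) else b j k.

Lemma gval_assemble a b j k : (k <= N j)%N -> gval (assemble a b) j k =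
  if k == 0%N then a (st j) else if k == N j then a (en j) else b j k.
Proof. by move=> kN; rewrite /gval /assemble inordK ?ltnS. Qed.

Lemma assemble_vertex_values a b : vertex_values st en (assemble a b) a.
Proof.
move=> j; rewrite !gval_assemble // !eqxx; split=> //.
by rewrite gtn_eqF // (nsteps_gt0 h_adm).
Qed.

Lemma gval_assemble_interior a b j k : (1 <= k < N j)%N ->
  gval (assemble a b) j k = b j k.
Proof.
move=> /andP[k_gt0 kN]; rewrite gval_assemble; last exact: ltnW.
by rewrite gtn_eqF // ltn_eqF.
Qed.

Lemma vertex_values_continuous (W : grid) w : vertex_values st en W w -> gcontinuous W.
Proof.
move=> Ww i; exists (w i); split=> j; rewrite ?stP ?enP => /eqP ->.
  by have [] := Ww j.
by have [] := Ww j.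
Qed.

Lemma continuous_vertex_values (W : grid) : (forall i, gcontinuous_at W i) ->
  exists w, vertex_values st en W w.
Proof.
move=> /choice[w wP]; exists w => j.
have [wp _] := wP (st j); have [_ wm] := wP (en j).
by split; [apply: wp; rewrite stP|apply: wm; rewrite enP].
Qed.

Definition mass (W : grid) : R := gdot W (gcst 1).

Lemma massE (W : grid) : mass W = \sum_j (\sum_(1 <= k < N j) h j * gval W j k
  + h j / 2 * gval W j 0 + h j / 2 * gval W j (N j)).
Proof.
rewrite /mass /gdot big_split /= (sum_incp stP) (sum_incm enP) addrA -!big_split /=.
apply: eq_bigr => j _; rewrite /gval /gcst !mulr1; congr (_ + _ + _).
by apply: eq_bigr => k _; rewrite mulr1.
Qed.

Lemma mass_nodes (W : grid) w : vertex_values st en W w ->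
  mass W = \sum_j \sum_(1 <= k < N j) h j * gval W j k + \sum_i weight G h i * w i.
Proof.
move=> Ww; rewrite massE.
under [X in _ = _ + X]eq_bigr do rewrite /weight mulrDl !mulr_suml.
rewrite [X in _ = _ + X]big_split /= (sum_incp stP) (sum_incm enP) -!big_split /=.
by apply: eq_bigr => j _; have [-> ->] := Ww j; rewrite addrA.
Qed.

Lemma mass_affine (W : grid) (a b : R) :
  mass (fun j k => a * W j k + b) = a * mass W + b * mass (gcst 1).
Proof.
rewrite !massE !mulr_sumr -big_split /=; apply: eq_bigr => j _.
rewrite /gval /gcst !mulrDr !mulr_sumr.
have -> : \sum_(1 <= k < N j) h j * (a * W j (inord k) + b) =
  \sum_(1 <= k < N j) a * (h j * W j (inord k)) + \sum_(1 <= k < N j) b * (h j * 1).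
  by rewrite -big_split /=; apply: eq_bigr => k _; ring.
by ring.
Qed.

Lemma mass_le (W W' : grid) :
  (forall j k, (k <= N j)%N -> gval W j k <= gval W' j k) -> mass W <= mass W'.
Proof.
move=> WW'; rewrite !massE; apply: ler_sum => j _.
have h_gt0 := step_gt0 h_adm j.
have h2_gt0 : 0 < h j / 2 by rewrite divr_gt0.
by rewrite !lerD // ?ler_pM2l // ?WW' //; apply: ler_sum_nat => k /andP[_ kN];
  rewrite ler_pM2l // WW' // ltnW.
Qed.

Lemma mass_term_le (W : grid) :
  (forall j k, (k <= N j)%N -> 0 <= gval W j k) ->
  forall j k, (k <= N j)%N -> h j / 2 * gval W j k <= mass W.
Proof.
move=> W_ge0 j k kN.
have h_gt0 i := step_gt0 h_adm i.
have h2_ge0 i : 0 <= h i / 2 by rewrite divr_ge0 // ltW.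
have int_ge0 i : 0 <= \sum_(1 <= q < N i) h i * gval W i q.
  by rewrite big_nat sumr_ge0 // => q /andP[_ qN]; rewrite mulr_ge0 ?W_ge0 1?ltnW // ltW.
have end_ge0 i q : (q <= N i)%N -> 0 <= h i / 2 * gval W i q.
  by move=> qN; rewrite mulr_ge0 ?W_ge0.
rewrite massE (bigD1 j) //=.
have rest_ge0 : 0 <= \sum_(i | i != j) (\sum_(1 <= q < N i) h i * gval W i q
  + h i / 2 * gval W i 0 + h i / 2 * gval W i (N i)).
  by apply: sumr_ge0 => i _; rewrite !addr_ge0 ?end_ge0.
have := int_ge0 j; have := end_ge0 j 0%N isT; have := end_ge0 j _ (leqnn _).
have [->|k_gt0] := posnP k; first by lra.
have [kN'|kN'] := ltnP k (N j); last first.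
  by have -> : k = N j by [apply/eqP; rewrite eqn_leq kN]; lra.
have : h j / 2 * gval W j k <= \sum_(1 <= q < N j) h j * gval W j q.
  rewrite (bigD1_seq k) ?mem_index_iota ?k_gt0 ?iota_uniq //= big_seq_cond.
  apply: ler_wpDr; last first.
    by have := W_ge0 j k kN; have := h_gt0 j; nra.
  apply: sumr_ge0 => q; rewrite mem_index_iota => /andP[/andP[_ qN] _].
  by rewrite mulr_ge0 ?W_ge0 1?ltnW // ltW.
lra.
Qed.


End Network.

(** * The discrete Fokker-Planck equation *)

Section Network.
Context {R : realType} {n : nat} {I J : finType}.
Variables (G : network_data R n I J) (HG : is_network G).
Variables (st en : J -> I).
Hypothesis stP : forall i j, (j \in incp G i) = (i == st j).
Hypothesis enP : forall i j, (j \in incm G i) = (i == en j).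
Variables (h : J -> R) (h_adm : admissible G h).

Local Notation N := (nsteps G h).
Local Notation grid := (grid_fun G h).

Lemma mass1_gt0 : 0 < mass (gcst 1 : grid).
Proof.
have /card_gt0P[j0 _] := has_edge HG.
apply: lt_le_trans (mass_term_le stP enP h_adm (W := gcst 1) _ (leq0n (N j0))).
  by rewrite mulr1 divr_gt0 // (step_gt0 h_adm).
by move=> j k _; apply: ler01.
Qed.

Definition pos_part (W : grid) : grid := fun j k => Num.max (W j k) 0.

(** A retraction onto [Kset]: the positive part is completed by a constant if its
    mass is less than 1, and is divided by its mass if this is larger than 1. *)
Definition normalize (W : grid) : grid := fun j k =>
  (Num.max (W j k) 0 + Num.max (1 - mass (pos_part W)) 0 / mass (gcst 1 : grid))
  / Num.max (mass (pos_part W)) 1.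

Lemma normalize_Kset (W : grid) w : vertex_values st en W w -> Kset (normalize W).
Proof.
move=> Ww; set m := mass (pos_part W).
have m1_gt0 : 0 < Num.max m 1 by rewrite lt_max ltr01 orbT.
split.
- apply: (vertex_values_continuous stP enP (w := fun i =>
    (Num.max (w i) 0 + Num.max (1 - m) 0 / mass (gcst 1 : grid)) / Num.max m 1)) => j.
  by have [<- <-] := Ww j.
- move=> j k; apply: divr_ge0; last exact: ltW.
  by rewrite addr_ge0 ?le_max ?lexx ?orbT // divr_ge0 ?le_max ?lexx ?orbT // ltW // mass1_gt0.
pose b := Num.max (1 - m) 0 / mass (gcst 1 : grid) / Num.max m 1.
have -> : normalize W = (fun j k => (Num.max m 1)^-1 * @pos_part W j k + b).
  apply/functional_extensionality_dep => j; apply/funext => k.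
  by rewrite /normalize -/m /b mulrDl mulrC.
rewrite -/(mass _) (mass_affine stP enP) /b -/m.
rewrite mulrAC [_ / mass _ * _]divfK ?gt_eqF ?mass1_gt0 // mulrC -mulrDl.
have [m_le1|m_gt1] := leP m 1.
  rewrite (max_l (_ : 0 <= 1 - m)) ?subr_ge0 // divr1 addrC subrK //.
by rewrite (max_r (_ : 1 - m <= 0)) ?subr_le0 ?(ltW m_gt1) // addr0 divff // gt_eqF // (lt_trans ltr01).
Qed.

Lemma normalize_id (W : grid) : Kset W -> normalize W = W.
Proof.
move=> [_ W_ge0 W1]; have posW : pos_part W = W.
  apply/functional_extensionality_dep => j; apply/funext => k.
  by rewrite /pos_part max_l.
apply/functional_extensionality_dep => j; apply/funext => k.
rewrite /normalize posW -[mass W]/(gdot W (gcst 1)) W1 subrr !maxxx mul0r addr0 divr1.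
by rewrite max_l.
Qed.

Variables (nu : J -> R) (g : J -> R -> R -> R -> R).
Hypothesis nu_gt0 : forall j, 0 < nu j.
Hypothesis dg1_le0 : forall j x q1 q2, 0 <= x <= len G j -> dgq1 g j x q1 q2 <= 0.
Hypothesis dg2_ge0 : forall j x q1 q2, 0 <= x <= len G j -> 0 <= dgq2 g j x q1 q2.

Definition fp_residual (U M : grid) j k : R := nu j * dd2 M j k + Bop g U M j k.

(** The diffusion and transport terms telescope on each edge, and the conditions at
    the vertices collect the remaining boundary terms. *)
Lemma fp_conservation (U M : grid) :
  \sum_j \sum_(1 <= k < N j) h j * fp_residual U M j k
  + \sum_i Top nu g M U i = 0.
Proof.
rewrite /Top sumrB (sum_incp stP) (sum_incm enP) -sumrB -big_split /=.
apply: big1 => j _; have h_gt0 := step_gt0 h_adm j.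
pose A k := gval M j k * along (dgq1 g) U j k.
pose C k := gval M j k * along (dgq2 g) U j k.
pose F k := nu j * dplus M j k.-1 + (if k == 1%N then 0 else A k.-1)
  + (if k == N j then 0 else C k).
have N1 : (1 < N j)%N := nsteps_gt1 h_adm j.
rewrite (telescope_sumr_eq F).
- by rewrite /F eqxx (gtn_eqF N1) (ltn_eqF N1) /A /C /=; ring.
- exact: ltnW.
move=> k /andP[k_gt0 kN]; rewrite /F /fp_residual /Bop (dd2E h_adm) //=.
rewrite (ltn_eqF kN) eqSS (gtn_eqF k_gt0) -[_ == (N j).-1]eqSS prednK ?(ltnW N1) //.
rewrite -/(A k) -/(A k.-1) -/(C k) -/(C k.+1).
by case: eqP => _; case: eqP => _; field; rewrite gt_eqF.
Qed.

(* Where a nonnegative function vanishes, only the inflow from its neighbours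
   remains, and it has the right sign because g is monotone. *)
Section Nonnegative.
Variables (U M : grid).
Hypothesis M_ge0 : forall j k, (k <= N j)%N -> 0 <= gval M j k.

Lemma fp_residual_ge0 j k : (1 <= k < N j)%N -> gval M j k = 0 ->
  0 <= fp_residual U M j k.
Proof.
move=> /andP[k_gt0 kN] Mk0; have h_gt0 := step_gt0 h_adm j.
have M1 : 0 <= gval M j k.-1 by apply: M_ge0; lia.
have M2 : 0 <= gval M j k.+1 by apply: M_ge0.
have a1 q : (q <= N j)%N -> along (dgq1 g) U j q <= 0.
  by move=> qN; apply: dg1_le0; apply: grid_point.
have a2 q : (q <= N j)%N -> 0 <= along (dgq2 g) U j q.
  by move=> qN; apply: dg2_ge0; apply: grid_point.
rewrite /fp_residual /dd2 /Bop Mk0 mulr0 !mul0r subr0 addr_ge0 //.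
  by rewrite mulr_ge0 ?(ltW (nu_gt0 j)) // divr_ge0 ?sqr_ge0 // addr_ge0.
rewrite mulr_ge0 ?invr_ge0 ?(ltW h_gt0) // sub0r subr0 addr_ge0 //.
  case: ifP => _; first by rewrite oppr0.
  by rewrite oppr_ge0 mulr_ge0_le0 // a1 //; lia.
by case: ifP => // _; rewrite mulr_ge0 // a2.
Qed.

Lemma Top_ge0 m i : vertex_values st en M m -> m i = 0 -> 0 <= Top nu g M U i.
Proof.
move=> Mm mi0; rewrite /Top subr_ge0.
have a1 j q : (q <= N j)%N -> along (dgq1 g) U j q <= 0.
  by move=> qN; apply: dg1_le0; apply: grid_point.
have a2 j q : (q <= N j)%N -> 0 <= along (dgq2 g) U j q.
  by move=> qN; apply: dg2_ge0; apply: grid_point.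
have N_gt0 j := nsteps_gt0 h_adm j.
have h_gt0 j := step_gt0 h_adm j.
apply: (@le_trans _ _ 0).
  apply: sumr_le0 => j; rewrite enP => /eqP ij.
  have Npred : ((N j).-1 <= N j)%N := leq_pred _.
  rewrite /dplus prednK // (Mm j).2 -ij mi0 sub0r.
  rewrite -[leRHS]addr0 lerD //; last by rewrite mulr_ge0_le0 ?M_ge0 ?a1.
  by rewrite pmulr_rle0 // pmulr_lle0 ?invr_gt0 // oppr_le0 M_ge0.
apply: sumr_ge0 => j; rewrite stP => /eqP ij.
rewrite /dplus (Mm j).1 -ij mi0 subr0 addr_ge0 //.
  by rewrite mulr_ge0 ?(ltW (nu_gt0 j)) // divr_ge0 ?(ltW (h_gt0 j)) // M_ge0.
by rewrite mulr_ge0 ?M_ge0 ?a2.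
Qed.

End Nonnegative.

(** One explicit step for the evolution whose stationary states are sought.  The
    vertex [i] carries the mass [weight G h i], whence the division. *)
Definition fp_step (U M : grid) (m : I -> R) : grid :=
  assemble st en (fun i => m i + Top nu g M U i / weight G h i)
    (fun j k => gval M j k + fp_residual U M j k).

Lemma mass_fp_step (U M : grid) m : vertex_values st en M m ->
  mass (fp_step U M m) = mass M.
Proof.
move=> Mm; have yv := assemble_vertex_values st en h_adm
  (fun i => m i + Top nu g M U i / weight G h i)
  (fun j k => gval M j k + fp_residual U M j k).
rewrite (mass_nodes stP enP yv) (mass_nodes stP enP Mm).
have -> : \sum_i weight G h i * (m i + Top nu g M U i / weight G h i) =
    \sum_i weight G h i * m i + \sum_i Top nu g M U i.
  rewrite -big_split /=; apply: eq_bigr => i _; field.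
  by rewrite gt_eqF // (weight_gt0 HG stP enP).
have -> : \sum_j \sum_(1 <= k < N j) h j * gval (fp_step U M m) j k =
    \sum_j \sum_(1 <= k < N j) h j * gval M j k +
    \sum_j \sum_(1 <= k < N j) h j * fp_residual U M j k.
  rewrite -big_split /=; apply: eq_bigr => j _; rewrite -big_split /=.
  apply: eq_big_nat => k kN; rewrite /fp_step gval_assemble_interior //.
  exact: mulrDr.
by have := fp_conservation U M; lra.
Qed.

(** Let [y] be the result of the step and [mu] the mass of its positive part.  As [y]
    has mass 1, [mu >= 1] and the positive part of [y] is [mu] times [M].  Where
    [M = 0], [y >= 0], so that [y = mu * M] everywhere; comparing the masses,
    [mu = 1]. *)
Lemma fp_fixed (U M : grid) m : vertex_values st en M m -> Kset M ->
  normalize (fp_step U M m) = M ->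
  (forall j k, (1 <= k < N j)%N -> fp_residual U M j k = 0) /\
  (forall i, Top nu g M U i = 0).
Proof.
move=> Mm [_ M_ge0 M1] Mfix; set y := fp_step U M m in Mfix.
have gM_ge0 j k : (k <= N j)%N -> 0 <= gval M j k by move=> _; apply: M_ge0.
have mass_y : mass y = 1 by rewrite mass_fp_step.
set mu := mass (pos_part y).
have mu_ge1 : 1 <= mu.
  rewrite -mass_y; apply: (mass_le stP enP h_adm) => j k _.
  by rewrite /gval /pos_part le_max lexx.
have mu_gt0 : 0 < mu := lt_le_trans ltr01 mu_ge1.
have y_pos j k : (k <= N j)%N -> Num.max (gval y j k) 0 = mu * gval M j k.
  move=> _; rewrite -[in RHS]Mfix /gval /normalize -/mu.
  rewrite [Num.max (1 - mu) 0]max_r ?subr_le0 // mul0r addr0 [Num.max mu 1]max_l //.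
  by rewrite mulrC divfK // gt_eqF.
have yv : vertex_values st en y (fun i => m i + Top nu g M U i / weight G h i).
  exact: assemble_vertex_values.
have w_gt0 i : 0 < weight G h i := weight_gt0 HG stP enP i h_adm.
have y_end i : m i = 0 -> 0 <= m i + Top nu g M U i / weight G h i.
  by move=> mi0; rewrite mi0 add0r divr_ge0 ?(ltW (w_gt0 i)) // (Top_ge0 U gM_ge0 Mm).
have y_int j k : (1 <= k < N j)%N -> gval y j k = gval M j k + fp_residual U M j k.
  by move=> kN; rewrite /y /fp_step gval_assemble_interior.
have y_ge0 j k : (k <= N j)%N -> gval M j k = 0 -> 0 <= gval y j k.
  move=> kN; have [->|k_gt0] := posnP k.
    by rewrite (Mm j).1 (yv j).1; apply: y_end.
  have [kN'|kN'] := ltnP k (N j).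
    by move=> Mk0; rewrite y_int ?k_gt0 // Mk0 add0r fp_residual_ge0 ?k_gt0.
  have -> : k = N j by apply/eqP; rewrite eqn_leq kN.
  by rewrite (Mm j).2 (yv j).2; apply: y_end.
have yM j k : (k <= N j)%N -> gval y j k = mu * gval M j k.
  move=> kN; have := y_pos j k kN; have [Mk0|Mk0] := eqVneq (gval M j k) 0.
    by rewrite Mk0 mulr0 max_l // y_ge0.
  have : 0 < mu * gval M j k by rewrite mulr_gt0 // lt_def Mk0 gM_ge0.
  rewrite -(y_pos j k kN) lt_max ltxx orbF => y_gt0 _.
  by rewrite max_l // ltW.
have mu1 : mu = 1.
  have : mass y = mu * mass M + 0 * mass (gcst 1 : grid).
    rewrite -(mass_affine stP enP); congr mass; apply: gridP => j k kN.
    by rewrite yM // /gval addr0.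
  by rewrite mass_y mul0r addr0 -[mass M]/(gdot M (gcst 1)) M1 mulr1.
split=> [j k kN|i].
  have /andP[_ /ltnW kN'] := kN.
  by have := yM j k kN'; rewrite y_int // mu1 mul1r; lra.
have [j ij] := vertex_incident HG stP enP i.
have : m i + Top nu g M U i / weight G h i = m i.
  case/orP: ij => /eqP ->.
    by have := yM j 0%N isT; rewrite (yv j).1 (Mm j).1 mu1 mul1r.
  by have := yM j (N j) (leqnn _); rewrite (yv j).2 (Mm j).2 mu1 mul1r.
move=> /eqP; rewrite -subr_eq0 addrAC subrr add0r mulf_eq0 invr_eq0.
by rewrite (gt_eqF (w_gt0 i)) orbF => /eqP.
Qed.

End Network.

(** * Regularity of the numerical Hamiltonian *)

Section NumericalHamiltonian.
Local Open Scope classical_set_scope.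
Local Open Scope ring_scope.
Context {R : realType} {n : nat} {I J : finType}.
Variables (G : network_data R n I J) (HG : is_network G).
Variables (g : J -> R -> R -> R -> R).
Hypotheses (g1 : G1 G g) (g3 : G3 G g).

Lemma cont_comp3 (S : topologicalType) (F : R * R * R -> R) (x a b : S -> R) :
  continuous F -> continuous x -> continuous a -> continuous b ->
  continuous (fun s => F (x s, a s, b s)).
Proof.
move=> cF cx ca cb s; apply: (@continuous_comp _ _ _ (fun s => (x s, a s, b s)) F).
  exact: (cvg_pair (cvg_pair (cx s) (ca s)) (cb s)).
exact: cF.
Qed.

Let C1_extension j : exists F : R * R * R -> R,
  [/\ forall p, differentiable F p, forall v, continuous (fun p => 'd F p v) &
      forall x q1 q2, 0 <= x <= len G j -> g j x q1 q2 = F (x, q1, q2)].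
Proof.
have [F [dF cF FE]] := g3 j; exists F; split=> // x q1 q2 x_in.
by rewrite (FE (x, q1, q2)) // inE.
Qed.

Lemma g_cont j x (S : topologicalType) (a b : S -> R) : 0 <= x <= len G j ->
  continuous a -> continuous b -> continuous (fun s => g j x (a s) (b s)).
Proof.
have [F [dF _ FE]] := C1_extension j => x_in ca cb.
under eq_fun do rewrite FE //.
apply: cont_comp3 => //; last exact: cst_continuous.
by move=> p; apply: differentiable_continuous.
Qed.

(* The difference quotients of [f] are those of [F] in the direction [v]. *)
Let derive1_partial (F : R * R * R -> R) (f : R -> R) (p v : R * R * R) (q : R) :
  differentiable F p -> (forall t, f (t + q) = F (t *: v + p)) ->
  derivable f q 1 /\ derive1 f q = 'd F p v.
Proof.
move=> dF fF; have f0 : f q = F p by have := fF 0; rewrite scale0r !add0r.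
have quotE : (fun t => t^-1 *: (f (t + q) - f q)) =
    (fun t => t^-1 *: ((F \o shift p) (t *: v) - F p)).
  by apply/funext => t; rewrite fF f0.
split.
  have := @diff_derivable _ _ _ F p v dF; rewrite /derivable -quotE.
  suff -> : (fun t => t^-1 *: ((f \o shift q) (t *: 1) - f q)) =
    (fun t => t^-1 *: (f (t + q) - f q)) by [].
  by apply/funext => t /=; rewrite scaler1.
by rewrite /derive1 quotE -deriveE.
Qed.

Let partial1 j (F : R * R * R -> R) x q1 q2 : (forall p, differentiable F p) ->
  (forall x q1 q2, 0 <= x <= len G j -> g j x q1 q2 = F (x, q1, q2)) ->
  0 <= x <= len G j ->
  derivable (fun q => g j x q q2) q1 1 /\ dgq1 g j x q1 q2 = 'd F (x, q1, q2) (0, 1, 0).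
Proof.
move=> dF FE x_in; apply: derive1_partial => // t; rewrite FE //.
by congr F; congr (_, _, _) => /=; rewrite ?scaler0 ?scaler1 ?add0r.
Qed.

Let partial2 j (F : R * R * R -> R) x q1 q2 : (forall p, differentiable F p) ->
  (forall x q1 q2, 0 <= x <= len G j -> g j x q1 q2 = F (x, q1, q2)) ->
  0 <= x <= len G j ->
  derivable (fun q => g j x q1 q) q2 1 /\ dgq2 g j x q1 q2 = 'd F (x, q1, q2) (0, 0, 1).
Proof.
move=> dF FE x_in; apply: derive1_partial => // t; rewrite FE //.
by congr F; congr (_, _, _) => /=; rewrite ?scaler0 ?scaler1 ?add0r.
Qed.

Lemma dgq1_cont j x (S : topologicalType) (a b : S -> R) : 0 <= x <= len G j ->
  continuous a -> continuous b -> continuous (fun s => dgq1 g j x (a s) (b s)).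
Proof.
have [F [dF cF FE]] := C1_extension j => x_in ca cb.
under eq_fun do rewrite (partial1 _ _ dF FE x_in).2.
exact: (@cont_comp3 S (fun p => 'd F p (0, 1, 0)) (fun=> x) _ _ (cF _) (@cst_continuous _ _ x)).
Qed.

Lemma dgq2_cont j x (S : topologicalType) (a b : S -> R) : 0 <= x <= len G j ->
  continuous a -> continuous b -> continuous (fun s => dgq2 g j x (a s) (b s)).
Proof.
have [F [dF cF FE]] := C1_extension j => x_in ca cb.
under eq_fun do rewrite (partial2 _ _ dF FE x_in).2.
exact: (@cont_comp3 S (fun p => 'd F p (0, 0, 1)) (fun=> x) _ _ (cF _) (@cst_continuous _ _ x)).
Qed.

Lemma derive1_ge0 (f : R -> R) (q : R) : {homo f : x y / x <= y} ->
  derivable f q 1 -> 0 <= derive1 f q.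
Proof.
move=> f_incr df; apply: limr_ge.
  have := df; rewrite /derivable.
  suff -> : (fun t => t^-1 *: ((f \o shift q) (t *: 1) - f q)) =
    (fun t => t^-1 *: (f (t + q) - f q)) by [].
  by apply/funext => t /=; rewrite scaler1.
near=> t; rewrite /GRing.scale /=.
have [t_ge0|t_lt0] := leP 0 t.
  by rewrite mulr_ge0 ?invr_ge0 // subr_ge0 f_incr // lerDr.
by rewrite mulr_le0 ?invr_le0 ?(ltW t_lt0) // subr_le0 f_incr // gerDr ltW.
Unshelve. all: by end_near. Qed.

Lemma dgq1_le0 j x q1 q2 : 0 <= x <= len G j -> dgq1 g j x q1 q2 <= 0.
Proof.
have [F [dF cF FE]] := C1_extension j => x_in.
have [df _] := partial1 q1 q2 dF FE x_in.
rewrite -oppr_ge0 /dgq1 !derive1E -deriveN // -derive1E.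
apply: derive1_ge0; last exact: derivableN.
by move=> q q' qq'; rewrite lerN2; apply: (g1 x_in).1.
Qed.

Lemma dgq2_ge0 j x q1 q2 : 0 <= x <= len G j -> 0 <= dgq2 g j x q1 q2.
Proof.
have [F [dF cF FE]] := C1_extension j => x_in.
have [df _] := partial2 q1 q2 dF FE x_in.
by apply: derive1_ge0 => // q q'; apply: (g1 x_in).2.
Qed.

Lemma g_zero_bounded : exists h0, 0 <= h0 /\
  forall j x, 0 <= x <= len G j -> `|g j x 0 0| <= h0.
Proof.
have /choice[b bP] : forall j, exists b, 0 <= b /\
    forall x, 0 <= x <= len G j -> `|g j x 0 0| <= b.
  move=> j; have [F [dF _ FE]] := C1_extension j.
  have cF : continuous (fun x : R => `|F (x, 0, 0)|).
    move=> x; apply: (@cvg_norm _ _ _ (nbhs x)); move: x.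
    apply: (@cont_comp3 _ F id (fun=> 0) (fun=> 0)); try exact: cst_continuous.
      by move=> p; apply: differentiable_continuous.
    by move=> x; apply: cvg_id.
  have [c _ c_max] := EVT_max (ltW (len_gt0 HG j)) (continuous_subspaceT cF).
  exists `|F (c, 0, 0)|; split=> // x x_in; rewrite FE //.
  by apply: c_max; rewrite in_itv.
exists (\sum_j b j); split=> [|j x x_in].
  by apply: sumr_ge0 => j _; have [] := bP j.
have [_ /(_ x x_in)/le_trans] := bP j; apply.
by rewrite (bigD1 j) //= lerDl sumr_ge0 // => k _; have [] := bP k.
Qed.

Hypothesis g4 : G4 G g.

Lemma g_bounded_below : exists C, 0 <= C /\
  forall j x q1 q2, 0 <= x <= len G j -> - C <= g j x q1 q2.
Proof.
have [al [C [ga [al_gt0 _ gP]]]] := g4.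
exists `|C|; split=> // j x q1 q2 x_in; apply: le_trans (gP j x q1 q2 x_in).
rewrite lerBrDr (@le_trans _ _ 0) //; first by rewrite addrC subr_le0 ler_norm.
by rewrite mulr_ge0 ?(ltW al_gt0) // powR_ge0.
Qed.

End NumericalHamiltonian.

(** * Continuity of the discrete operators *)

Section GridNorms.
Context {R : realType} {n : nat} {I J : finType}.
Variables (G : network_data R n I J) (h : J -> R).

Lemma gnorm_ge (U : grid_fun G h) j k : `|gval U j k| <= gnorm U.
Proof.
apply: le_trans (le_bigmax 0 (fun j => \big[Num.max/0]_k `|U j k|) j).
exact: (le_bigmax 0 (fun k => `|U j k|) (inord k)).
Qed.

Lemma gnorm_le (U : grid_fun G h) (b : R) : 0 <= b ->
  (forall j k, (k <= nsteps G h j)%N -> `|gval U j k| <= b) -> gnorm U <= b.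
Proof.
move=> b_ge0 Ub; apply: bigmax_le => // j _; apply: bigmax_le => // k _.
by rewrite -gval_ord Ub // -ltnS.
Qed.

Lemma dnorm_le (U : grid_fun G h) (b : R) : 0 <= b ->
  (forall j k, (k < nsteps G h j)%N -> `|dplus U j k| <= b) -> dnorm U <= b.
Proof.
by move=> b_ge0 Ub; apply: bigmax_le => // j _; apply: bigmax_le => // k _; apply: Ub.
Qed.

End GridNorms.

Section Continuity.
Local Open Scope classical_set_scope.
Local Open Scope ring_scope.
Context {R : realType} {n : nat} {I J : finType}.
Variables (G : network_data R n I J) (h : J -> R) (h_adm : admissible G h).
Variable S : topologicalType.

Local Notation N := (nsteps G h).
Local Notation grid := (grid_fun G h).

Definition grid_cont (W : S -> grid) : Prop :=
  forall j (k : 'I_(N j).+1), continuous (fun s => W s j k).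

Lemma gval_cont W j k : grid_cont W -> continuous (fun s => gval (W s) j k).
Proof. by move=> cW; apply: cW. Qed.

Lemma dplus_cont W j k : grid_cont W -> continuous (fun s => dplus (W s) j k).
Proof.
move=> cW; apply: contM; last exact: cst_continuous.
by apply: contB; apply: gval_cont.
Qed.

Lemma dd2_cont W j k : grid_cont W -> continuous (fun s => dd2 (W s) j k).
Proof.
move=> cW; apply: contM; last exact: cst_continuous.
apply: contD; last exact: gval_cont.
apply: contB; first exact: gval_cont.
by apply: contM; [exact: cst_continuous|exact: gval_cont].
Qed.

Lemma load_cont W i : grid_cont W -> continuous (fun s => load (W s) i).
Proof.
move=> cW; apply: contD; apply: cont_sum => j _;
  by apply: contM; [exact: cst_continuous|exact: gval_cont].
Qed.

Lemma flux_cont nu W i : grid_cont W -> continuous (fun s => flux nu (W s) i).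
Proof.
move=> cW; apply: contB; apply: cont_sum => j _;
  by apply: contM; [exact: cst_continuous|exact: dplus_cont].
Qed.

Lemma mass_cont W : grid_cont W -> continuous (fun s => mass (W s)).
Proof.
move=> cW; apply: contD.
  apply: cont_sum => j _; apply: cont_sum => k _.
  apply: contM; last exact: cst_continuous.
  by apply: contM; [exact: cst_continuous|exact: gval_cont].
apply: cont_sum => i _; apply: contD; apply: cont_sum => j _;
  (apply: contM; last exact: cst_continuous);
  by apply: contM; [exact: cst_continuous|exact: gval_cont].
Qed.

Lemma gnorm_cont W : grid_cont W -> continuous (fun s => gnorm (W s)).
Proof.
have cont_bigmax (T : finType) (F : T -> S -> R) : (forall t, continuous (F t)) ->
    continuous (fun s => \big[Num.max/0]_t F t s).
  move=> cF; elim: (index_enum T) => [|t r IHr].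
    by under eq_fun do rewrite big_nil; apply: cst_continuous.
  under eq_fun do rewrite big_cons.
  exact: cont_max.
move=> cW; apply: (cont_bigmax _ _) => j; apply: (cont_bigmax _ _) => k.
move=> s; apply: (@cvg_norm _ _ _ (nbhs s)); exact: cW.
Qed.

Lemma normalize_cont W : grid_cont W -> grid_cont (fun s => normalize (W s)).
Proof.
move=> cW j k; have c_pos : grid_cont (fun s => pos_part (W s)).
  by move=> i q; apply: cont_max; [exact: cW|exact: cst_continuous].
apply: contM; last first.
  apply: contV => [s|]; first by rewrite gt_eqF // lt_max ltr01 orbT.
  by apply: cont_max; [exact: mass_cont|exact: cst_continuous].
apply: contD; first exact: c_pos.
apply: contM; last exact: cst_continuous.
apply: cont_max; last exact: cst_continuous.
by apply: contB; [exact: cst_continuous|exact: mass_cont].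
Qed.

Lemma assemble_cont st en (a : S -> I -> R) (b : S -> J -> nat -> R) :
  (forall i, continuous (fun s => a s i)) ->
  (forall j k, (1 <= k < N j)%N -> continuous (fun s => b s j k)) ->
  grid_cont (fun s => assemble st en (a s) (b s)).
Proof.
move=> ca cb j k; rewrite /assemble.
have [k0|k0] := eqVneq (k : nat) 0%N; first exact: ca.
have [kN|kN] := eqVneq (k : nat) (N j); first exact: ca.
by apply: cb; rewrite lt0n k0 ltn_neqAle kN -ltnS /=.
Qed.

(** The operator is only known to be continuous on [Kset], which is why the family
    has to stay in this set. *)
Lemma operator_cont (V : grid -> grid) W :
  (forall M, Kset M -> forall eps : R, 0 < eps -> exists2 delta : R, 0 < delta &
     forall M', Kset M' -> gnorm (gsub M' M) < delta ->
       gnorm (gsub (V M') (V M)) < eps) ->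
  (forall s, Kset (W s)) -> grid_cont W -> grid_cont (fun s => V (W s)).
Proof.
move=> V_cont KW cW j k s; apply/cvgrPdist_lt => eps eps_gt0.
have [delta delta_gt0 deltaP] := V_cont _ (KW s) _ eps_gt0.
have c_dist : continuous (fun t => gnorm (gsub (W t) (W s))).
  apply: gnorm_cont => i q; apply: contB; first exact: cW.
  exact: cst_continuous.
have dist0 : gnorm (gsub (W s) (W s)) < delta.
  apply: le_lt_trans delta_gt0; apply: gnorm_le => // i q _.
  by rewrite /gval /gsub subrr normr0.
have near_s : \forall t \near s, gnorm (gsub (W t) (W s)) < delta.
  by apply: (c_dist s [set x | x < delta]); apply: lt_nbhsl.
apply: filterS near_s => t /(deltaP _ (KW t)); apply: le_lt_trans.
by rewrite distrC; have := gnorm_ge (gsub (V (W t)) (V (W s))) j k; rewrite /gval inord_val.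
Qed.

Variables (g : J -> R -> R -> R -> R) (g3 : G3 G g) (nu : J -> R).

Section Along.
Variables (U : S -> grid) (cU : grid_cont U).

Lemma along_cont (f : J -> R -> R -> R -> R) j k :
  (forall j x (a b : S -> R), 0 <= x <= len G j ->
     continuous a -> continuous b -> continuous (fun s => f j x (a s) (b s))) ->
  (k <= N j)%N -> continuous (fun s => along f (U s) j k).
Proof. by move=> cf kN; apply: cf; [exact: grid_point|exact: dplus_cont..]. Qed.

Lemma hjb_residual_cont W (Lambda : S -> R) j k : grid_cont W -> continuous Lambda ->
  (k <= N j)%N -> continuous (fun s => hjb_residual nu g (U s) (W s) (Lambda s) j k).
Proof.
move=> cW cL kN; apply: contB; last exact: gval_cont.
apply: contD => //; apply: contD.
  by apply: contM; [exact: cst_continuous|exact: dd2_cont].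
by apply: along_cont => // i x a b; apply: g_cont.
Qed.

Variables (M : S -> grid) (cM : grid_cont M).

Let a1_cont j k : (k <= N j)%N ->
  continuous (fun s => gval (M s) j k * along (dgq1 g) (U s) j k).
Proof.
move=> kN; apply: contM; first exact: gval_cont.
by apply: along_cont => // i x a b; apply: dgq1_cont.
Qed.

Let a2_cont j k : (k <= N j)%N ->
  continuous (fun s => gval (M s) j k * along (dgq2 g) (U s) j k).
Proof.
move=> kN; apply: contM; first exact: gval_cont.
by apply: along_cont => // i x a b; apply: dgq2_cont.
Qed.

Lemma fp_residual_cont j k : (1 <= k < N j)%N ->
  continuous (fun s => fp_residual nu g (U s) (M s) j k).
Proof.
move=> /andP[k_gt0 kN].
apply: contD; first by apply: contM; [exact: cst_continuous|exact: dd2_cont].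
apply: contM; first exact: cst_continuous.
apply: contB; last by apply: a2_cont; apply: ltnW.
apply: contD; last by case: (k == (N j).-1); [exact: cst_continuous|exact: a2_cont].
apply: contB; first by apply: a1_cont; apply: ltnW.
by case: (k == 1%N); [exact: cst_continuous|apply: a1_cont; lia].
Qed.

Lemma Top_cont i : continuous (fun s => Top nu g (M s) (U s) i).
Proof.
apply: contB; apply: cont_sum => j _; apply: contD.
- by apply: contM; [exact: cst_continuous|exact: dplus_cont].
- by apply: a2_cont; apply: nsteps_gt0.
- by apply: contM; [exact: cst_continuous|exact: dplus_cont].
- by apply: a1_cont; apply: leq_pred.
Qed.

End Along.
End Continuity.

(** * The fixed point *)

Section Clamp.
Context {R : realType}.

Definition clamp (r x : R) : R := Num.max (- r) (Num.min r x).

Lemma clamp_bound r x : 0 <= r -> - r <= clamp r x <= r.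
Proof.
move=> r_ge0; rewrite /clamp le_max lexx /= ge_max ge_min lexx /= andbT.
by rewrite (@le_trans _ _ 0) // oppr_le0.
Qed.

Lemma clamp_fixed r x F : 0 <= r -> x = clamp r (x - F) ->
  (- r < x -> F <= 0) /\ (x < r -> 0 <= F).
Proof.
move=> r_ge0 xE; split=> [x_gt|x_lt].
  have : x <= Num.min r (x - F).
    have := x_gt; rewrite {1}xE /clamp lt_max ltxx /= => mn_gt.
    by rewrite {1}xE /clamp max_r // ltW.
  by rewrite le_min => /andP[_]; rewrite lerBrDl gerDr.
have : Num.min r (x - F) <= x by rewrite {2}xE /clamp le_max lexx orbT.
by rewrite ge_min leNgt x_lt /= lerBlDr lerDl.
Qed.

End Clamp.

Section Existence.
Context {R : realType} {n : nat} {I J : finType}.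
Variables (G : network_data R n I J) (HG : is_network G).
Variables (st en : J -> I).
Hypothesis stP : forall i j, (j \in incp G i) = (i == st j).
Hypothesis enP : forall i j, (j \in incm G i) = (i == en j).
Variables (h : J -> R) (h_adm : admissible G h).

Local Notation N := (nsteps G h).
Local Notation grid := (grid_fun G h).

Variables (nu : J -> R) (g : J -> R -> R -> R -> R).
Hypothesis g3 : G3 G g.
Variable V : grid -> grid.
Hypothesis V_cont : forall M, Kset M -> forall eps : R, 0 < eps ->
  exists2 delta : R, 0 < delta &
    forall M', Kset M' -> gnorm (gsub M' M) < delta -> gnorm (gsub (V M') (V M)) < eps.

(** The unknowns are the values of U and M at all the indices [(j, k)], so that the
    indices of a vertex carry independent values.  [glue] makes a grid function
    continuous by choosing one of the values at each vertex; as the fixed point map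
    only produces continuous functions, it does not alter a fixed point. *)
Lemma relaxed_exists (r : R) (j0 : J) : 0 <= r ->
  exists (U M : grid) (u m : I -> R),
    [/\ relaxed_solution st en nu g r U u (V M) (gval U j0 0),
        vertex_values st en M m, Kset M & normalize (fp_step st en nu g U M m) = M].
Proof.
move=> r_ge0.
have /choice[e eP] := vertex_incident HG stP enP.
pose vval (W : grid) i :=
  if i == st (e i) then gval W (e i) 0 else gval W (e i) (N (e i)).
pose glue (W : grid) : grid := assemble st en (vval W) (gval W).
have vvalE W w : vertex_values st en W w -> vval W = w.
  move=> Ww; apply/funext => i; rewrite /vval; case: ifP => [/eqP i_st|i_st].
    by rewrite (Ww _).1 -i_st.
  by rewrite (Ww _).2; have := eP i; rewrite i_st /= => /eqP <-.
have glueE W w : vertex_values st en W w -> glue W = W.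
  move=> Ww; apply: gridP => j k kN; rewrite gval_assemble // (vvalE W w Ww).
  case: eqP => [->|_]; first by rewrite (Ww j).1.
  by case: eqP => [->|//]; rewrite (Ww j).2.
pose Y := (bool * {j : J & 'I_(N j).+1})%type : finType.
pose unpack (b : bool) (z : Y -> R) : grid := fun j k =>
  z (b, Tagged (fun j => 'I_(N j).+1) k).
pose Uof z := glue (unpack true z).
pose Mof z := normalize (glue (unpack false z)).
pose Wof z := V (Mof z).
pose Lof z := gval (Uof z) j0 0.
(* at a vertex the residual of the equation is minus Sop *)
pose PhiU z : grid := assemble st en
  (fun i => clamp r (vval (Uof z) i - - Sop nu (Uof z) (gsub (Wof z) (gcst (Lof z))) i))
  (fun j k => clamp r (gval (Uof z) j k - hjb_residual nu g (Uof z) (Wof z) (Lof z) j k)).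
pose stepM z := fp_step st en nu g (Uof z) (Mof z) (vval (Mof z)).
pose Phi (z : Y -> R) (y : Y) : R := let: (b, x) := y in
  (if b then PhiU z else normalize (stepM z)) (tag x) (tagged x).
have MofK z : Kset (Mof z).
  exact: (normalize_Kset HG stP enP h_adm (assemble_vertex_values st en h_adm _ _)).
have PhiMK z : Kset (normalize (stepM z)).
  exact: (normalize_Kset HG stP enP h_adm (assemble_vertex_values st en h_adm _ _)).
have Phi_cont : family_continuous Phi.
  move=> S w cw; have c_unpack b : grid_cont (fun s => unpack b (w s)).
    by move=> j k; apply: cw.
  have c_vval (W : S -> grid) i : grid_cont W -> continuous (fun s => vval (W s) i).
    by move=> cW; rewrite /vval; case: (i == _); apply: gval_cont.
  have c_glue (W : S -> grid) : grid_cont W -> grid_cont (fun s => glue (W s)).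
    move=> cW; apply: assemble_cont => [i|j k _]; first exact: c_vval.
    exact: gval_cont.
  have cU : grid_cont (fun s => Uof (w s)) by apply: c_glue.
  have cM : grid_cont (fun s => Mof (w s)) by apply: normalize_cont; apply: c_glue.
  have cW : grid_cont (fun s => Wof (w s)) by apply: operator_cont.
  have cL : continuous (fun s => Lof (w s)) by apply: gval_cont.
  have c_clamp (f : S -> R) : continuous f -> continuous (fun s => clamp r (f s)).
    move=> cf; apply: cont_max; first exact: cst_continuous.
    by apply: cont_min; first exact: cst_continuous.
  have cPU : grid_cont (fun s => PhiU (w s)).
    apply: assemble_cont => [i|j k /andP[_ kN]]; apply: c_clamp; apply: contB.
    - exact: c_vval.
    - apply: contN; under eq_fun do rewrite SopE load_cst.
      apply: contD; first exact: flux_cont.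
      apply: contB; first exact: load_cont.
      by apply: contM; first exact: cst_continuous.
    - exact: gval_cont.
    - by apply: hjb_residual_cont => //; apply: ltnW.
  have cPM : grid_cont (fun s => normalize (stepM (w s))).
    apply: normalize_cont; apply: assemble_cont => [i|j k kN].
      apply: contD; first exact: c_vval.
      by apply: contM; [exact: Top_cont|exact: cst_continuous].
    by apply: contD; [exact: gval_cont|exact: fp_residual_cont].
  by move=> [[] [j k]]; [exact: cPU|exact: cPM].
have Phi_le z y : `|Phi z y| <= r + \sum_j 2 / h j.
  have h2_ge0 j : 0 <= 2 / h j by rewrite divr_ge0 // ltW // (step_gt0 h_adm).
  case: y => [[] [j k]] /=.
    apply: ler_wpDr; first by rewrite sumr_ge0.
    rewrite ler_norml /PhiU /assemble.
    by do 2?[case: ifP => _]; apply: clamp_bound.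
  apply: ler_wpDl => //; have [_ M_ge0 M1] := PhiMK z.
  rewrite ger0_norm //.
  have := mass_term_le stP enP h_adm (W := normalize (stepM z)) (fun j k _ => M_ge0 _ _)
    (ltn_ord k : k <= N j)%N.
  rewrite /mass M1 gval_ord => M_le.
  apply: (@le_trans _ _ (2 / h j)).
    by rewrite ler_pdivlMr ?(step_gt0 h_adm) //; lra.
  by rewrite (bigD1 j) //= lerDl sumr_ge0.
have [z zE] := brouwer_bounded Phi_cont Phi_le.
have UE : unpack true z = PhiU z.
  apply/functional_extensionality_dep => j; apply/funext => k.
  exact: (esym (congr1 (@^~ (true, Tagged (fun j => 'I_(N j).+1) k)) zE)).
have ME : unpack false z = normalize (stepM z).
  apply/functional_extensionality_dep => j; apply/funext => k.
  exact: (esym (congr1 (@^~ (false, Tagged (fun j => 'I_(N j).+1) k)) zE)).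
have [m Mm] : exists m, vertex_values st en (unpack false z) m.
  by apply: (continuous_vertex_values stP enP); rewrite ME; have [] := PhiMK z.
have U_E : Uof z = unpack true z.
  by rewrite /Uof; apply: glueE; rewrite UE; apply: assemble_vertex_values.
have M_E : Mof z = unpack false z.
  rewrite /Mof (glueE _ _ Mm); apply: normalize_id; rewrite ME; exact: PhiMK.
have uu : vertex_values st en (Uof z) (vval (Uof z)).
  have : vertex_values st en (Uof z) (fun i => clamp r (vval (Uof z) i -
      - Sop nu (Uof z) (gsub (Wof z) (gcst (Lof z))) i)).
    by rewrite {1}U_E UE; apply: assemble_vertex_values.
  by move=> Uv; rewrite (vvalE _ _ Uv).
have U_fix : Uof z = PhiU z by rewrite U_E.
have vval_fix i : vval (Uof z) i = clamp r (vval (Uof z) i -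
    - Sop nu (Uof z) (gsub (Wof z) (gcst (Lof z))) i).
  have /vvalE/(congr1 (@^~ i)) <- : vertex_values st en (PhiU z) (fun i => clamp r (vval (Uof z) i -
      - Sop nu (Uof z) (gsub (Wof z) (gcst (Lof z))) i)).
    exact: assemble_vertex_values.
  by rewrite -U_fix.
exists (Uof z), (Mof z), (vval (Uof z)), m; split.
- split=> //.
  + move=> j k kN; rewrite U_fix /PhiU gval_assemble //.
    by do 2?[case: ifP => _]; apply: clamp_bound.
  + move=> j k kN; apply: clamp_fixed => //.
    by rewrite {1}U_fix /PhiU gval_assemble_interior.
  + move=> i; have [lo hi] := clamp_fixed r_ge0 (vval_fix i).
    by split=> [/lo|/hi]; rewrite ?oppr_le0 ?oppr_ge0.
  + by move=> /(_ j0 0%N isT) ->; rewrite oppr_le0.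
  + by move=> /(_ j0 0%N isT) ->.
- by rewrite M_E.
- exact: MofK.
- by rewrite {2}M_E ME /stepM (vvalE _ _ (_ : vertex_values st en (Mof z) m)) // M_E.
Qed.

End Existence.

(** * Solutions of the discrete system *)

Section Shift.
Context {R : realType} {n : nat} {I J : finType}.
Variables (G : network_data R n I J) (h : J -> R) (h_adm : admissible G h).
Variables (U : grid_fun G h) (c : R).

Definition shift_grid : grid_fun G h := fun j k => U k - c.

Lemma dplus_shift : dplus shift_grid = dplus U.
Proof.
by apply/funext => j; apply/funext => k; rewrite /dplus /gval /shift_grid; ring.
Qed.

Lemma dd2_shift j k : (0 < k)%N -> dd2 shift_grid j k = dd2 U j k.
Proof. by move=> k_gt0; rewrite !(dd2E h_adm) // dplus_shift. Qed.

Lemma along_shift (f : J -> R -> R -> R -> R) : along f shift_grid = along f U.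
Proof. by apply/funext => j; apply/funext => k; rewrite /along dplus_shift. Qed.

End Shift.

Section Solutions.
Context {R : realType} {n : nat} {I J : finType}.
Variables (G : network_data R n I J) (HG : is_network G).
Variables (st en : J -> I).
Hypothesis stP : forall i j, (j \in incp G i) = (i == st j).
Hypothesis enP : forall i j, (j \in incm G i) = (i == en j).
Variables (nu : J -> R) (g : J -> R -> R -> R -> R).
Hypothesis nu_gt0 : forall j, 0 < nu j.
Variable V : forall h : J -> R, grid_fun G h -> grid_fun G h.
Arguments V : clear implicits.

Lemma mean_zero_le h (h_adm : admissible G h) (U : grid_fun G h) (D : R) :
  gdot U (gcst 1) = 0 ->
  (forall j k j' k', (k <= nsteps G h j)%N -> (k' <= nsteps G h j')%N ->
     `|gval U j k - gval U j' k'| <= D) ->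
  forall j k, (k <= nsteps G h j)%N -> `|gval U j k| <= D.
Proof.
move=> U0 osc j k kN; have m1 := mass1_gt0 HG stP enP h_adm.
have cst_mass (a : R) : mass (gcst a : grid_fun G h) = a * mass (gcst 1 : grid_fun G h).
  rewrite -[RHS]add0r -[X in X + _](mul0r (mass (gcst 1 : grid_fun G h))).
  rewrite -(mass_affine stP enP); congr mass.
  by apply: gridP => ? ? _; rewrite /gval /gcst mul0r add0r.
rewrite ler_norml; apply/andP; split.
  have : mass U <= mass (gcst (gval U j k + D) : grid_fun G h).
    apply: (mass_le stP enP h_adm) => j' k' k'N.
    have := osc j k j' k' kN k'N; rewrite ler_norml /gval /gcst => /andP[]; lra.
  rewrite cst_mass /mass U0 pmulr_lge0 //; lra.
have : mass (gcst (gval U j k - D) : grid_fun G h) <= mass U.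
  apply: (mass_le stP enP h_adm) => j' k' k'N.
  have := osc j k j' k' kN k'N; rewrite ler_norml /gval /gcst => /andP[]; lra.
rewrite cst_mass /mass U0 pmulr_lle0 //; lra.
Qed.

Lemma solution_relaxed h (h_adm : admissible G h) (U M : grid_fun G h) Lambda :
  mfg_solution nu g V U M Lambda -> exists r u,
    relaxed_solution st en nu g r U u (V h M) Lambda.
Proof.
case=> hjb _ kirU _ U_cont _ _.
have [u Uu] := continuous_vertex_values stP enP U_cont.
have /card_gt0P[j0 _] := has_edge HG.
have U_lt j k : `|gval U j k| < gnorm U + 1.
  by apply: le_lt_trans (gnorm_ge U j k) _; rewrite ltrDl.
exists (gnorm U + 1), u; split=> //.
- by move=> j k _; rewrite -ler_norml ltW.
- by move=> j k kN; rewrite /hjb_residual hjb // subrr.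
- by move=> i; rewrite kirU.
- move=> /(_ j0 0%N isT) U0; have := U_lt j0 0%N.
  by rewrite U0 normrN ltNge ler_norm.
- move=> /(_ j0 0%N isT) U0; have := U_lt j0 0%N.
  by rewrite U0 ltNge ler_norm.
Qed.

(** The equations see [U] through its differences only, which leaves a constant free
    to achieve mean zero. *)
Lemma relaxed_solution_mfg h (h_adm : admissible G h) r (U M : grid_fun G h) u m Lambda :
  G1 G g -> G3 G g ->
  relaxed_solution st en nu g r U u (V h M) Lambda ->
  (forall j k, (k <= nsteps G h j)%N -> `|gval U j k| < r) ->
  vertex_values st en M m -> Kset M -> normalize (fp_step st en nu g U M m) = M ->
  exists U', mfg_solution nu g V U' M Lambda.
Proof.
move=> g1 g3 rel U_lt Mm KM M_fix.
have [fp_int fp_vtx] := fp_fixed HG stP enP h_adm nu_gt0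
  (dgq1_le0 g1 g3) (dgq2_ge0 g1 g3) Mm KM M_fix.
have Uu := relaxed_vertex_values rel.
have u_lt i : `|u i| < r.
  have [j /orP[/eqP->|/eqP->]] := vertex_incident HG stP enP i.
    by rewrite -(Uu j).1 U_lt.
  by rewrite -(Uu j).2 U_lt.
pose c := mass U / mass (gcst 1 : grid_fun G h).
have m1 := mass1_gt0 HG stP enP h_adm.
exists (shift_grid U c); split=> //.
- move=> j k kN; rewrite (dd2_shift h_adm) ?(andP kN).1 // along_shift.
  apply: subr0_eq; have := U_lt j k (ltnW (andP kN).2); rewrite ltr_norml => /andP[lo hi].
  have [/(_ lo) r1 /(_ hi) r2] := relaxed_interior rel kN.
  by apply/eqP; rewrite eq_le; apply/andP.
- move=> j k kN; have := fp_int j k kN.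
  by rewrite /fp_residual /Bop along_shift along_shift.
- move=> i; have := u_lt i; rewrite ltr_norml => /andP[lo hi].
  have [/(_ lo) r1 /(_ hi) r2] := relaxed_vertex rel i.
  have -> : Sop nu (shift_grid U c) (gsub (V h M) (gcst Lambda)) i =
      Sop nu U (gsub (V h M) (gcst Lambda)) i by rewrite /Sop dplus_shift.
  by apply/eqP; rewrite eq_le r2 r1.
- by move=> i; have := fp_vtx i; rewrite /Top !along_shift.
- apply: (vertex_values_continuous stP enP (w := fun i => u i - c)) => j.
  by have [<- <-] := Uu j.
- have -> : shift_grid U c = (fun j k => 1 * U j k + - c).
    by apply: gridP => j k _; rewrite /gval /shift_grid mul1r.
  rewrite -/(mass _) (mass_affine stP enP) mul1r mulNr /c divfK ?subrr //.
  by rewrite gt_eqF.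
Qed.

End Solutions.

Theorem theorem3p1 (R : realType) (n : nat) (I J : finType)
    (G : network_data R n I J) (HG : is_network G)
    (nu : J -> R) (nu_gt0 : forall j, 0 < nu j)
    (H : J -> R -> R -> R) (HH : hamiltonian G H)
    (g : J -> R -> R -> R -> R)
    (g1 : G1 G g) (g2 : G2 G H g) (g3 : G3 G g) (g4 : G4 G g)
    (V : forall h : J -> R, grid_fun G h -> grid_fun G h) (v1 : V1 V) :
  (forall h : J -> R, admissible G h ->
     exists (U M : grid_fun G h) (Lambda : R), mfg_solution nu g V U M Lambda) /\
  (exists C1 C2 : R, forall h : J -> R, admissible G h ->
     forall (U M : grid_fun G h) (Lambda : R), mfg_solution nu g V U M Lambda ->
       `|Lambda| <= C1 /\ gnorm U + dnorm U <= C2).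
Proof.
have [V_cont [B0 V_le]] := v1.
have [st [en [stP enP]]] := arc_ends HG.
have [h0 [h0_ge0 g_zero]] := g_zero_bounded HG g3.
have [Cg [Cg_ge0 g_lower]] := g_bounded_below g4.
have [K [D [K_ge0 D_ge0 apriori]]] := relaxed_apriori HG stP enP nu_gt0 g1
  (normr_ge0 B0) h0_ge0 Cg_ge0 g_zero g_lower.
have W_le h (h_adm : admissible G h) (M : grid_fun G h) : Kset M ->
    forall j k, (k <= nsteps G h j)%N -> `|gval (V h M) j k| <= `|B0|.
  move=> KM j k _; apply: le_trans (gnorm_ge _ j k) _.
  exact: le_trans (V_le h h_adm M KM) (ler_norm _).
have /card_gt0P[j0 _] := has_edge HG.
split=> [h h_adm|].
  pose r := `|B0| + h0 + D + 1.
  have r_ge0 : 0 <= r by rewrite !addr_ge0.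
  have [U [M [u [m [rel Mm KM M_fix]]]]] :=
    relaxed_exists HG stP enP h_adm nu g3 (V_cont h h_adm) j0 r_ge0.
  have [L_le _ osc] := apriori r h h_adm U u _ _ rel (W_le h h_adm M KM).
  have [|U' sol] := relaxed_solution_mfg HG stP enP nu_gt0 h_adm g1 g3 rel _ Mm KM M_fix.
    move=> j k kN; have := osc j k j0 0%N kN isT; move: L_le.
    rewrite !ler_norml ltr_norml => /andP[l1 l2] /andP[d1 d2].
    by apply/andP; split; rewrite /r; lra.
  by exists U', M, (gval U j0 0).
exists (`|B0| + h0), (D + K) => h h_adm U M Lambda sol.
have [r [u rel]] := solution_relaxed HG stP enP h_adm sol.
have [L_le pK osc] := apriori r h h_adm U u _ _ rel (W_le h h_adm M (mfg_density sol)).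
split=> //; apply: lerD; last exact: dnorm_le.
apply: gnorm_le => //.
exact: (mean_zero_le HG stP enP h_adm (mfg_normalized sol)).
Qed.
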